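(* Let $n\ge 3$, let $1\le \ell\le n-2$, let $P\subset\mathbb{R}^n$ be an $n$-dimensional polytope, and let $P_N=[X_1,\dots,X_N]$ be the convex hull of $N$ independent random points distributed uniformly on the boundary $\partial P$. Then, as $N\to\infty$, $$\mathbb{E} f_\ell(P_N)\ \ge\ c_{n-1,\ell}\,\operatorname{flag}(P)\,(\ln N)^{n-2}(1+o(1)),$$ where $c_{n-1,\ell}$ is the constant (independent of $P$) defined in the context.
   Context: $f_\ell(Q)$ is the number of $\ell$-dimensional faces of a polytope $Q$. A flag of an $n$-dimensional polytope $P$ is a sequence $F_0\subset F_1\subset\dots\subset F_{n-1}$ of faces of $P$ with $\dim F_i=i$; $\operatorname{flag}(P)$ is the number of flags of $P$. Uniformly distributed on $\partial P$ means with respect to normalized $(n-1)$-dimensional Hausdorff measure on $\partial P$. Definition of $c_{d,\ell}$: by known results (Bárány–Buchta, Reitzner), for every $d\geq 1$ and $\ell\in\{0,\dots,d-1\}$ there is a constant $c_{d,\ell}$, depending only on $d$ and $\ell$, such that for every $d$-dimensional polytope $Q\subset\mathbb{R}^d$ the convex hull $Q_N$ of $N$ independent points distributed uniformly in $Q$ (i.e. with respect to normalized $d$-dimensional Lebesgue measure on $Q$) satisfies $\mathbb{E} f_\ell(Q_N)=c_{d,\ell}\operatorname{flag}(Q)(\ln N)^{d-1}(1+o(1))$ as $N\to\infty$. This known fact may be taken as given. *)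

(* Defs.v *)
From HB Require Import structures.
From mathcomp Require Import all_boot all_order all_algebra finmap.
From mathcomp Require Import all_classical all_reals all_analysis.

Set Implicit Arguments.
Unset Strict Implicit.
Unset Printing Implicit Defensive.

Import Order.TTheory GRing.Theory Num.Theory.
Import numFieldNormedType.Exports.

Local Open Scope classical_set_scope.
Local Open Scope ring_scope.

(* Row vectors 'rV[R]_n model R^n.  The library norm on them is the sup norm;
   it induces the usual topology, but metric notions below (dot product,
   diameter) are the Euclidean ones. *)

Definition dotv (R : realType) (n : nat) (x y : 'rV[R]_n) : R :=
  \sum_(i < n) x 0 i * y 0 i.

Definition edist (R : realType) (n : nat) (x y : 'rV[R]_n) : R :=
  Num.sqrt (dotv (x - y) (x - y)).

Definition conv_hull (R : realType) (n : nat) (A : set 'rV[R]_n) :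
    set 'rV[R]_n :=
  smallest (@convex_set R 'rV[R]_n) A.

Definition aff_hull (R : realType) (n : nat) (A : set 'rV[R]_n) :
    set 'rV[R]_n :=
  [set x | exists (k : nat) (p : 'I_k -> 'rV[R]_n) (w : 'I_k -> R),
    [/\ forall i, A (p i), \sum_(i < k) w i = 1
      & x = \sum_(i < k) w i *: p i]].

(* dim A = k: the affine hull of A is a translate x0 + U of a k-dimensional
   linear subspace U, given as the row space of a matrix.  The empty set has
   no dimension, so the empty face is never counted below. *)
Definition has_dim (R : realType) (n : nat) (A : set 'rV[R]_n) (k : nat) :
    Prop :=
  exists (x0 : 'rV[R]_n) (U : 'M[R]_n),
    \rank U = k /\ aff_hull A = [set x | (x - x0 <= U)%MS].

Definition is_polytope (R : realType) (n : nat) (P : set 'rV[R]_n) : Prop :=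
  exists2 V : set 'rV[R]_n, finite_set V & P = conv_hull V.

(* The choice a = 0 makes P itself (b = 0) and the empty set (b > 0) faces. *)
Definition is_face (R : realType) (n : nat) (P F : set 'rV[R]_n) : Prop :=
  exists (a : 'rV[R]_n) (b : R),
    (forall x, P x -> dotv a x <= b) /\ F = P `&` [set x | dotv a x = b].

(* The sets counted by nfaces and nflags are finite when P is a polytope; on
   infinite sets fset_set returns the empty set. *)
Definition nfaces (R : realType) (n l : nat) (P : set 'rV[R]_n) : nat :=
  #|` fset_set [set F | is_face P F /\ has_dim F l]|.

Definition nflags (R : realType) (n : nat) (P : set 'rV[R]_n) : nat :=
  #|` fset_set [set F : {ffun 'I_n -> set 'rV[R]_n} |
      (forall i : 'I_n, is_face P (F i) /\ has_dim (F i) i) /\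
      (forall i j : 'I_n, (i < j)%N -> F i `<` F j)]|.

Definition boundary (R : realType) (n : nat) (P : set 'rV[R]_n) :
    set 'rV[R]_n :=
  closure P `\` interior P.

Definition ediam (R : realType) (n : nat) (A : set 'rV[R]_n) : \bar R :=
  ereal_sup [set y | y = 0%E \/
                     exists u v, [/\ A u, A v & y = (edist u v)%:E]].

(* s-dimensional Hausdorff (outer) measure, for s > 0, without the conventional
   constant factor: it is only used after normalization. *)
Definition hausdorff_pre (R : realType) (n s : nat) (delta : R)
    (A : set 'rV[R]_n) : \bar R :=
  ereal_inf [set y | exists C : nat -> set 'rV[R]_n,
    [/\ A `<=` \bigcup_k C k, forall k, (ediam (C k) <= delta%:E)%E
      & y = (\sum_(0 <= k <oo) ediam (C k) ^+ s)%E]].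

Definition hausdorff (R : realType) (n s : nat) (A : set 'rV[R]_n) : \bar R :=
  ereal_sup [set hausdorff_pre s delta A | delta in [set delta | 0 < delta]].

(* n-dimensional Lebesgue (outer) measure on R^n. *)
Definition lebesgue_rV (R : realType) (n : nat) (A : set 'rV[R]_n) : \bar R :=
  ereal_inf [set y | exists a b : nat -> 'rV[R]_n,
    [/\ forall k i, a k 0 i <= b k 0 i,
        A `<=` \bigcup_k [set x | forall i, a k 0 i <= x 0 i < b k 0 i]
      & y = (\sum_(0 <= k <oo) (\prod_(i < n) (b k 0 i - a k 0 i))%:E)%E]].

(* R^n with its Borel sigma-algebra. *)
Notation borel_rV R n := (g_sigma_algebraType (@open 'rV[R]_n)).

(* X has law A |-> m (A `&` S) / m S, where m stands for a measure with
   0 < m S < +oo. *)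
Definition uniform_on (R : realType) (n : nat) (m : set 'rV[R]_n -> \bar R)
    (S : set 'rV[R]_n) (d : measure_display) (T : measurableType d)
    (Pr : probability T R) (X : {RV Pr >-> borel_rV R n}) : Prop :=
  forall A : set (borel_rV R n), measurable A ->
    distribution Pr X A = (fine (m (A `&` S)) / fine (m S))%:E.

(* Subfamilies are covered by taking A i to be the whole space. *)
Definition mutually_independent (R : realType) (n N : nat)
    (d : measure_display) (T : measurableType d) (Pr : probability T R)
    (X : 'I_N -> {RV Pr >-> borel_rV R n}) : Prop :=
  forall A : 'I_N -> set (borel_rV R n), (forall i, measurable (A i)) ->
    Pr [set w | forall i, A i (X i w)] =
    (\prod_(i < N) Pr (X i @^-1` A i))%E.

Definition uniform_sample (R : realType) (n N : nat)
    (m : set 'rV[R]_n -> \bar R) (S : set 'rV[R]_n)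
    (d : measure_display) (T : measurableType d) (Pr : probability T R)
    (X : 'I_N -> {RV Pr >-> borel_rV R n}) : Prop :=
  (forall i, uniform_on m S (X i)) /\ mutually_independent X.

Definition random_polytope (R : realType) (n N : nat)
    (d : measure_display) (T : measurableType d) (Pr : probability T R)
    (X : 'I_N -> {RV Pr >-> borel_rV R n}) (w : T) : set 'rV[R]_n :=
  conv_hull [set (X i w : 'rV[R]_n) | i in [set: 'I_N]].

Definition expected_nfaces (R : realType) (n N l : nat)
    (d : measure_display) (T : measurableType d) (Pr : probability T R)
    (X : 'I_N -> {RV Pr >-> borel_rV R n}) : \bar R :=
  ('E_Pr[fun w => (nfaces l (random_polytope X w))%:R])%E.

(* c is the constant c_{d,l}: for every d-polytope Q in R^d and independent
   points uniform in Q, E f_l(Q_N) = c flag(Q) (ln N)^(d-1) (1 + o(1)).  For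
   each N the N points may live on their own probability space. *)
Definition is_face_constant (R : realType) (d l : nat) (c : R) : Prop :=
  forall (Q : set 'rV[R]_d), is_polytope Q -> has_dim Q d ->
  forall (disp : nat -> measure_display)
    (T : forall N, measurableType (disp N))
    (Pr : forall N, probability (T N) R)
    (X : forall N, 'I_N -> {RV (Pr N) >-> borel_rV R d}),
  (forall N, uniform_sample (@lebesgue_rV R d) Q (@X N)) ->
  exists2 o : nat -> R, o @ \oo --> 0 &
    \forall N \near \oo,
      expected_nfaces l (@X N) =
      (c * (nflags Q)%:R * ln N%:R ^+ d.-1 * (1 + o N))%:E.

(* Main.v *)
(* Let F range over the facets of P.  The part of P_N in F is the convex hull of the sample
   points lying in F, it is a face of P_N, and almost surely no sample point lies in two
   facets; so f_l(P_N) is at least the sum over F of the number of l-faces of P_N inside F.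
   Given which points lie in F, these are independent and uniform in F, and their number is
   binomial, of logarithm ln N (1 + o(1)).  The defining property of c_(n-1,l), applied to F
   in affine coordinates, gives c flag(F) (ln N)^(n-2) for each facet, and the flags of the
   facets add up to the flags of P.

   In affine coordinates y |-> p0 + y B of the hyperplane of F, the Hausdorff measure is an
   outer measure scaling like lambda^(n-1) under homotheties.  This alone makes it at most
   kappa times the Lebesgue outer measure, with equality on bounded Borel sets because there
   the Lebesgue outer measure is additive.

   Numbers of faces are never shown to be measurable: expectations of nonnegative functions
   are suprema over simple functions below them, and such lower integrals are superadditive. *)

(* The defining formula of [c] concerns one sequence of probability spaces, with an error term that
   may depend on the sequence, whereas conditioning on which points fall in a facet creates a new
   space for every index set. The estimate is therefore first made uniform over all spaces. It must
   then be glued: for each index set [I] a simple function below the face count is chosen on the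
   event that exactly the points of [I] lie in the facet, and the sum of these functions is
   measurable whatever the count is.

   No area is ever computed. That the boundary has positive finite Hausdorff measure is extracted
   from the existence of a uniform law on it. A facet has positive measure because its chart is
   Lipschitz and the image contains a cube. The unknown factor [kappa] cancels in the conditional
   law, so neither the normalization of the Hausdorff measure nor the choice of coordinates, which
   need not be orthonormal, affects the result. *)
Require Import Defs.
From HB Require Import structures.
From mathcomp Require Import all_boot all_order all_algebra finmap.
From mathcomp Require Import all_classical all_reals all_analysis.
From mathcomp Require Import lebesgue_measure measurable_realfun.
From mathcomp Require Import ring lra zify.
Import Order.TTheory GRing.Theory Num.Theory.
Import numFieldNormedType.Exports.

Set Implicit Arguments.
Unset Strict Implicit.
Unset Printing Implicit Defensive.

Local Open Scope classical_set_scope.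
Local Open Scope ring_scope.

(** * Convex hulls and faces *)

Section DotProduct.
Context {R : realType}.

Lemma dotvE n (x y : 'rV[R]_n) : dotv x y = (x *m y^T) 0 0.
Proof. by rewrite mxE; apply: eq_bigr => i _; rewrite mxE. Qed.

Lemma dotvC n (x y : 'rV[R]_n) : dotv x y = dotv y x.
Proof. by apply: eq_bigr => i _; rewrite mulrC. Qed.

Lemma dotvDr n (a x y : 'rV[R]_n) : dotv a (x + y) = dotv a x + dotv a y.
Proof. by rewrite !dotvE linearD/= mulmxDr mxE. Qed.

Lemma dotvZr n (a x : 'rV[R]_n) t : dotv a (t *: x) = t * dotv a x.
Proof. by rewrite !dotvE linearZ/= -scalemxAr mxE. Qed.

Lemma dotvBr n (a x y : 'rV[R]_n) : dotv a (x - y) = dotv a x - dotv a y.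
Proof. by rewrite -[- y]scaleN1r dotvDr dotvZr mulN1r. Qed.

Lemma dotvDl n (a b x : 'rV[R]_n) : dotv (a + b) x = dotv a x + dotv b x.
Proof. by rewrite dotvC dotvDr !(dotvC x). Qed.

Lemma dotvZl n (a x : 'rV[R]_n) t : dotv (t *: a) x = t * dotv a x.
Proof. by rewrite dotvC dotvZr dotvC. Qed.

Lemma dotv0l n (x : 'rV[R]_n) : dotv 0 x = 0.
Proof. by rewrite dotvE mul0mx mxE. Qed.

Lemma dotv_sum n (I : finType) (a : 'rV[R]_n) (w : I -> R) (p : I -> 'rV[R]_n) :
  dotv a (\sum_i w i *: p i) = \sum_i w i * dotv a (p i).
Proof.
rewrite dotvE linear_sum mulmx_sumr summxE; apply: eq_bigr => i _.
by rewrite -dotvZr dotvE.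
Qed.

Lemma dotv_ge0 n (x : 'rV[R]_n) : 0 <= dotv x x.
Proof. by apply: sumr_ge0 => i _; rewrite -expr2 sqr_ge0. Qed.

Lemma dotv_eq0 n (x : 'rV[R]_n) : dotv x x = 0 -> x = 0.
Proof.
move=> x0; apply/rowP => i; rewrite mxE; apply/eqP.
rewrite -sqrf_eq0 expr2; apply/eqP/(psumr_eq0P _ x0) => // j _.
by rewrite -expr2 sqr_ge0.
Qed.

Lemma dotv_mulmxr n m (a : 'rV[R]_n) (y : 'rV[R]_m) (B : 'M[R]_(m, n)) :
  dotv a (y *m B) = dotv (a *m B^T) y.
Proof. by rewrite !dotvE trmx_mul mulmxA. Qed.

End DotProduct.

Section ConvexHull.
Context {R : realType}.

Lemma convex_setP n (C : set 'rV[R]_n) :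
  @convex_set R 'rV[R]_n C <->
  (forall x y t, 0 <= t <= 1 -> C x -> C y -> C (t *: x + (1 - t) *: y)).
Proof.
split=> [cC x y t /andP[t0 t1] Cx Cy|cC x y t /set_mem Cx /set_mem Cy].
  have := cC x y (Itv01 t0 t1); rewrite !inE => /(_ Cx Cy).
  by rewrite /conv/= .
rewrite inE; have := cC x y t%:num; rewrite /conv/= ; apply => //.
by apply/andP; split.
Qed.

(** Induction on the list of indices, each partial combination being divided by its total weight so
    that adding an index is a binary combination. Points of weight 0 may lie outside [C], hence the
    separate cases of a vanishing weight and of a vanishing partial sum. *)
Lemma convex_comb n (I : finType) (p : I -> 'rV[R]_n) (C : set 'rV[R]_n)
    (w : I -> R) :
  @convex_set R 'rV[R]_n C -> (forall i, 0 <= w i) ->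
  (forall i, w i != 0 -> C (p i)) -> \sum_i w i = 1 ->
  C (\sum_i w i *: p i).
Proof.
move=> /convex_setP cC w0 Cp w1.
suff H (r : seq I) : 0 < \sum_(i <- r) w i ->
    C ((\sum_(i <- r) w i)^-1 *: \sum_(i <- r) w i *: p i).
  by have := H (index_enum I); rewrite w1 invr1 scale1r; apply.
elim: r => [|i r IH]; first by rewrite big_nil ltxx.
rewrite !big_cons.
set s := \sum_(j <- r) _ in IH *; set u := \sum_(j <- r) _ in IH *.
have s0 : 0 <= s by apply: sumr_ge0.
move=> ws.
have [wi0|wi0] := eqVneq (w i) 0.
  by move: ws; rewrite wi0 scale0r !add0r; exact: IH.
have [s00|s00] := eqVneq s 0.
  have -> : u = 0.
    rewrite /u big_seq big1// => j jr.
    have : w j <= s.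
      rewrite /s (big_rem j)//= lerDl; exact: sumr_ge0.
    by rewrite s00 => wj; rewrite (le_anti (_ : w j <= 0 <= w j)) ?scale0r// wj w0.
  by rewrite s00 !addr0 scalerA mulVf// scale1r; exact: Cp.
have sp : 0 < s by rewrite lt_neqAle eq_sym s00.
have -> : (w i + s)^-1 *: (w i *: p i + u) =
    (w i / (w i + s)) *: p i + (1 - w i / (w i + s)) *: (s^-1 *: u).
  rewrite scalerDr !scalerA; congr (_ *: _ + _ *: _); first by rewrite mulrC.
  by field; rewrite s00 gt_eqF.
apply: cC; [|exact: Cp|exact: IH].
by rewrite divr_ge0 ?(ltW ws)//= ler_pdivrMr// mul1r lerDl.
Qed.

(** The weighted sums form a convex set containing the points; conversely [convex_comb] applies.
    Weights live on all of [I] and vanish off [J], so that hulls of different subfamilies share one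
    index type. *)
Lemma conv_hullE n (I : finType) (p : I -> 'rV[R]_n) (J : pred I) :
  conv_hull (p @` [set i | J i]) =
  [set x | exists w : I -> R, [/\ forall i, 0 <= w i,
     forall i, w i != 0 -> J i, \sum_i w i = 1 & x = \sum_i w i *: p i]].
Proof.
apply/seteqP; split=> x.
  apply; split; last first.
    move=> _ [i Ji <-]; exists (fun j => (j == i)%:R); split.
    - by move=> j; rewrite ler0n.
    - by move=> j; rewrite pnatr_eq0 eqb0 negbK => /eqP ->.
    - by rewrite (bigD1 i)//= eqxx big1 ?addr0// => j /negPf ->.
    - rewrite (bigD1 i)//= eqxx scale1r big1 ?addr0// => j /negPf ->.
      by rewrite scale0r.
  apply/convex_setP => y z t /andP[t0 t1] [w [w0 wJ w1 ->]] [v [v0 vJ v1 ->]].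
  exists (fun i => t * w i + (1 - t) * v i); split.
  - by move=> i; rewrite addr_ge0 ?mulr_ge0// subr_ge0.
  - move=> i; apply: contraNT => nJ.
    have -> : w i = 0 by apply/eqP; apply: contraNT nJ => /wJ.
    have -> : v i = 0 by apply/eqP; apply: contraNT nJ => /vJ.
    by rewrite !mulr0 addr0.
  - by rewrite big_split/= -!mulr_sumr w1 v1 !mulr1 subrKC.
  - rewrite !scaler_sumr -big_split/=; apply: eq_bigr => i _.
    by rewrite !scalerA -scalerDl.
move=> [w [w0 wJ w1 ->]] C [cC pC].
apply: (@convex_comb _ _ p C w) => // i /wJ Ji.
by apply: pC; exists i.
Qed.

Lemma conv_hull_rangeE n (I : finType) (p : I -> 'rV[R]_n) :
  conv_hull (range p) =
  [set x | exists w : I -> R, [/\ forall i, 0 <= w i,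
     \sum_i w i = 1 & x = \sum_i w i *: p i]].
Proof.
have -> : [set: I] = [set i | xpredT i] by apply/seteqP; split.
rewrite conv_hullE; apply/seteqP; split=> x [w].
  by move=> [? _ ? ?]; exists w.
by move=> [? ? ?]; exists w.
Qed.

Lemma sub_conv_hull n (A : set 'rV[R]_n) : A `<=` conv_hull A.
Proof. exact: sub_smallest. Qed.

Lemma conv_hull_convex n (A : set 'rV[R]_n) :
  forall x y t, 0 <= t <= 1 -> conv_hull A x -> conv_hull A y ->
  conv_hull A (t *: x + (1 - t) *: y).
Proof.
move=> x y t t01 Ax Ay C CA; have /convex_setP cC := CA.1.
exact: cC t01 (Ax C CA) (Ay C CA).
Qed.

Lemma polytopeP n (P : set 'rV[R]_n) : is_polytope P ->
  exists k (p : 'I_k -> 'rV[R]_n), P = conv_hull (range p).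
Proof.
move=> [V /finite_seqP[s ->] ->]; exists (size s), (tnth (in_tuple s)).
congr conv_hull; apply/seteqP; split=> x /=.
  by move=> /(nthP 0)[i si <-]; exists (Ordinal si) => //; rewrite (tnth_nth 0).
by move=> [i _ <-]; exact: mem_tnth.
Qed.

Lemma is_polytope_range n (I : finType) (p : I -> 'rV[R]_n) :
  is_polytope (conv_hull (range p)).
Proof.
exists (range p) => //; apply: finite_image. exact: finite_finset.
Qed.

Lemma is_polytope_image n (I : finType) (p : I -> 'rV[R]_n) (J : set I) :
  is_polytope (conv_hull (p @` J)).
Proof.
exists (p @` J) => //; apply: finite_image. exact: finite_finset.
Qed.

Lemma mx_continuous (T : topologicalType) m n (f : T -> 'M[R]_(m, n)) :
  (forall i j, continuous (fun x => f x i j)) -> continuous f.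
Proof.
move=> fc x A [P fP PA]; have H i j : \forall y \near x, P i j (f y i j).
  exact: fc (fP i j).
near=> y; apply: PA => i j; move: i j.
by near: y; do 2!apply: filter_forall => ?; exact: H.
Unshelve. all: by end_near. Qed.

Lemma mulmxr_continuous k n (M : 'M[R]_(k, n)) :
  continuous (fun w : 'rV[R]_k => w *m M).
Proof.
apply: mx_continuous => i j.
under eq_fun do rewrite mxE.
apply: continuous_big => [|l _ w]; first exact: add_continuous.
apply: (@cvgM R _ _ (nbhs_filter w) (fun x : 'rV[R]_k => x i l) (fun=> M l j)).
  exact: (@coord_continuous _ _ _ i l).
exact: cvg_cst.
Qed.

Lemma dotv_continuous n (a : 'rV[R]_n) : continuous (dotv a).
Proof.
apply: continuous_big => [|l _ w]; first exact: add_continuous.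
apply: (@cvgM R _ _ (nbhs_filter w) (fun=> a 0 l) (fun x : 'rV[R]_n => x 0 l)).
  exact: cvg_cst.
exact: (@coord_continuous _ _ _ 0 l).
Qed.

Lemma hyperplane_closed n (a : 'rV[R]_n) b : closed [set x | dotv a x = b].
Proof.
exact: ((continuous_closedP (dotv a)).1 (@dotv_continuous n a) _
  (@closed_eq R b)).
Qed.

(** The hull is the image of the compact standard simplex under a linear map. *)
Lemma polytope_closed n (P : set 'rV[R]_n) : is_polytope P -> closed P.
Proof.
move=> /polytopeP[k [p ->]].
pose S : set 'rV[R]_k :=
  [set w : 'rV[R]_k | forall i, `[0, 1]%classic (w 0 i)] `&` [set w | dotv (const_mx 1) w = 1].
have dot1 (w : 'rV[R]_k) : dotv (const_mx 1) w = \sum_i w 0 i.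
  by apply: eq_bigr => i _; rewrite mxE mul1r.
have -> : conv_hull (range p) = (fun w : 'rV[R]_k => w *m \matrix_i p i) @` S.
  rewrite conv_hull_rangeE; apply/seteqP; split=> x /=.
    move=> [w [w0 w1 ->]]; exists (\row_i w i).
      split=> /= [i|]; last by rewrite dot1; under eq_bigr do rewrite mxE.
      rewrite mxE in_itv/= w0/= -w1 (bigD1 i)//= lerDl; exact: sumr_ge0.
    rewrite mulmx_sum_row; apply: eq_bigr => i _.
    by rewrite mxE rowK.
  move=> [w [w01 w1] <-]; exists (w 0); split.
  - by move=> i; have := w01 i; rewrite /= in_itv/= => /andP[].
  - by rewrite -dot1.
  - by rewrite mulmx_sum_row; apply: eq_bigr => i _; rewrite rowK.
apply: compact_closed; first exact: norm_hausdorff.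
apply: continuous_compact.
  apply: continuous_subspaceT => w; exact: mulmxr_continuous.
have cS : compact [set w : 'rV[R]_k | forall i, `[0, 1]%classic (w 0 i)].
  by apply: (@rV_compact R k (fun=> `[0, 1]%classic)) => i; exact: segment_compact.
apply: (subclosed_compact _ cS); last by move=> w [].
apply: closedI.
  by apply: compact_closed => //; exact: norm_hausdorff.
exact: hyperplane_closed.
Qed.

End ConvexHull.

Section Faces.
Context {R : realType}.

Lemma comb_le n (I : finType) (p : I -> 'rV[R]_n) (w : I -> R) a b :
  (forall i, 0 <= w i) -> \sum_i w i = 1 -> (forall i, dotv a (p i) <= b) ->
  dotv a (\sum_i w i *: p i) <= b.
Proof.
move=> w0 w1 pb; rewrite dotv_sum -[leRHS]mul1r -w1 mulr_suml.
by apply: ler_sum => i _; rewrite ler_wpM2l.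
Qed.

(** The slacks [b - dotv a (p i)] are nonnegative and their weighted sum is 0, so each one with a
    nonzero weight vanishes. *)
Lemma comb_eq n (I : finType) (p : I -> 'rV[R]_n) (w : I -> R) a b :
  (forall i, 0 <= w i) -> \sum_i w i = 1 -> (forall i, dotv a (p i) <= b) ->
  dotv a (\sum_i w i *: p i) = b -> forall i, w i != 0 -> dotv a (p i) = b.
Proof.
move=> w0 w1 pb; rewrite dotv_sum => wb i.
have : \sum_i w i * (b - dotv a (p i)) = 0.
  under eq_bigr do rewrite mulrBr.
  by rewrite sumrB -mulr_suml w1 mul1r wb subrr.
move=> s0 wi0; have /psumr_eq0P : forall j, true -> 0 <= w j * (b - dotv a (p j)).
  by move=> j _; rewrite mulr_ge0// subr_ge0.
move=> /(_ s0 i isT)/eqP; rewrite mulf_eq0 (negPf wi0)/= subr_eq0.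
by move=> /eqP ->.
Qed.

Lemma face_conv n (I : finType) (p : I -> 'rV[R]_n) a b :
  (forall i, dotv a (p i) <= b) ->
  conv_hull (range p) `&` [set x | dotv a x = b] =
  conv_hull (p @` [set i | dotv a (p i) == b]).
Proof.
move=> pb; rewrite conv_hullE conv_hull_rangeE; apply/seteqP; split=> x.
  move=> [[w [w0 w1 ->]]] /= xb; exists w; split => // i wi.
  by apply/eqP; exact: comb_eq xb _ wi.
move=> [w [w0 wp w1 ->]]; split; first by exists w.
rewrite /= dotv_sum -[RHS]mul1r -w1 mulr_suml; apply: eq_bigr => i _.
by have [->|/wp/eqP ->] := eqVneq (w i) 0; rewrite ?mul0r.
Qed.

Lemma face_conv_hull n (I : finType) (p : I -> 'rV[R]_n) F :
  is_face (conv_hull (range p)) F -> exists2 J : {set I},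
    F = conv_hull (p @` [set` J]) & forall i, i \in J -> F (p i).
Proof.
move=> [a [b [Pb ->]]]; exists [set i | dotv a (p i) == b]%SET.
  rewrite face_conv; first by congr conv_hull; congr (_ @` _);
    apply/seteqP; split=> i /=; rewrite inE.
  by move=> i; apply: Pb; apply: sub_conv_hull; exists i.
by move=> i; rewrite inE => /eqP; split=> //; apply: sub_conv_hull; exists i.
Qed.

Lemma finite_faces n (P : set 'rV[R]_n) : is_polytope P ->
  finite_set [set F | is_face P F].
Proof.
move=> /polytopeP[k [p ->]].
apply: (@sub_finite_set _ _
  ((fun J : {set 'I_k} => conv_hull (p @` [set` J])) @` setT)).
  by move=> F /face_conv_hull[J -> _]; exists J.
by apply: finite_image; exact: finite_finset.
Qed.

Lemma face_has_vertex n (I : finType) (p : I -> 'rV[R]_n) F :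
  is_face (conv_hull (range p)) F -> F !=set0 -> exists i, F (p i).
Proof.
move=> /face_conv_hull[J FE Jp] [x]; rewrite {1}FE.
rewrite (@conv_hullE _ _ _ p (mem J)) => /= -[w [w0 wJ w1 _]].
have [[i wi]|w00] := pselect (exists i, w i != 0).
  by exists i; exact: Jp (wJ i wi).
move: w1; rewrite big1 => [/eqP|i _]; first by rewrite eq_sym oner_eq0.
by apply/eqP/negPn/negP => wi; apply: w00; exists i.
Qed.

Lemma face_sub n (P F : set 'rV[R]_n) : is_face P F -> F `<=` P.
Proof. by move=> [a [b [_ ->]]] x []. Qed.

(* The functional [a' + M a] with M large exposes the subface. *)
Lemma face_trans n (P F G : set 'rV[R]_n) :
  is_polytope P -> is_face P F -> is_face F G -> is_face P G.
Proof.
move=> /polytopeP[k [p ->]] [a [b [Pb FE]]] [a' [b' [Fb' ->]]].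
have pb i : dotv a (p i) <= b by apply: Pb; apply: sub_conv_hull; exists i.
pose M := 1 + \sum_i `|(dotv a' (p i) - b') / (b - dotv a (p i))|.
have key i : dotv a (p i) != b ->
    dotv a' (p i) - b' < M * (b - dotv a (p i)).
  move=> ne; have bp : 0 < b - dotv a (p i) by rewrite subr_gt0 lt_neqAle ne pb.
  rewrite -ltr_pdivrMr// /M (bigD1 i)//= addrA.
  apply: (@lt_le_trans _ _ (1 + `|(dotv a' (p i) - b') / (b - dotv a (p i))|)).
    by rewrite (le_lt_trans (ler_norm _))// ltrDr.
  by rewrite lerDl; apply: sumr_ge0.
have Fp i : dotv a (p i) = b -> dotv a' (p i) <= b'.
  move=> pib; apply: Fb'; rewrite FE; split => //.
  by apply: sub_conv_hull; exists i.
have pb'' i : dotv (a' + M *: a) (p i) <= b' + M * b.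
  rewrite dotvDl dotvZl; have [e|/key/ltW h] := eqVneq (dotv a (p i)) b.
    by rewrite e lerD2r Fp.
  by move: h; rewrite mulrBr; lra.
exists (a' + M *: a), (b' + M * b); split.
  by move=> x; rewrite conv_hull_rangeE => -[w [w0 w1 ->]]; exact: comb_le.
rewrite FE; apply/seteqP; split=> x /=.
  by move=> [[Px xb] xb']; split=> //; rewrite dotvDl dotvZl xb xb'.
move=> []; rewrite conv_hull_rangeE => Px xb''; have [w [w0 w1 xE]] := Px.
have wp i : w i != 0 -> dotv a (p i) = b.
  move=> wi; have := comb_eq w0 w1 pb''; rewrite -xE => /(_ xb'' i wi).
  rewrite dotvDl dotvZl; have [//|/key] := eqVneq (dotv a (p i)) b.
  by rewrite mulrBr; lra.
have xb : dotv a x = b.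
  rewrite xE dotv_sum -[RHS]mul1r -w1 mulr_suml; apply: eq_bigr => i _.
  by have [->|/wp ->] := eqVneq (w i) 0; rewrite ?mul0r.
split; first by split.
by move: xb''; rewrite /= dotvDl dotvZl xb; lra.
Qed.

End Faces.

(** * Affine hulls and dimension *)

Section AffineDimension.
Context {R : realType}.

Lemma sub_aff_hull n (A : set 'rV[R]_n) : A `<=` aff_hull A.
Proof.
move=> x Ax; exists 1%N, (fun=> x), (fun=> 1); split => //.
  by rewrite big_ord1.
by rewrite big_ord1 scale1r.
Qed.

Lemma aff_hullS n (A B : set 'rV[R]_n) : A `<=` B -> aff_hull A `<=` aff_hull B.
Proof.
by move=> AB x [k [p [w [Ap w1 ->]]]]; exists k, p, w; split=> // i; exact: AB.
Qed.

Lemma aff_hull_hyperplane n (A : set 'rV[R]_n) a b :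
  A `<=` [set x | dotv a x = b] -> aff_hull A `<=` [set x | dotv a x = b].
Proof.
move=> Ab x [k [p [w [Ap w1 ->]]]] /=.
rewrite dotv_sum -[RHS]mul1r -w1 mulr_suml; apply: eq_bigr => i _.
by rewrite (Ab _ (Ap i)).
Qed.

Lemma has_dim_nonempty n (A : set 'rV[R]_n) k : has_dim A k -> A !=set0.
Proof.
move=> [x0 [U [_ AU]]].
have : aff_hull A x0 by rewrite AU /= subrr sub0mx.
move=> [[|m] [p [w [Ap w1 _]]]]; last by exists (p ord0).
by move: w1; rewrite big_ord0 => /eqP; rewrite eq_sym oner_eq0.
Qed.

Lemma flat_sub n (x0 x1 : 'rV[R]_n) (U V : 'M[R]_n) :
  [set x | (x - x0 <= U)%MS] `<=` [set x | (x - x1 <= V)%MS] ->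
  (U <= V)%MS /\ (x0 - x1 <= V)%MS.
Proof.
move=> UV; have x01 : (x0 - x1 <= V)%MS by apply: UV; rewrite /= subrr sub0mx.
split=> //; apply/row_subP => i.
have /UV /= : [set x | (x - x0 <= U)%MS] (row i U + x0).
  by rewrite /= addrK row_sub.
rewrite -addrA => H; rewrite -[row i U](addrK (x0 - x1)).
by rewrite addmx_sub ?eqmx_opp.
Qed.

Lemma has_dim_uniq n (A : set 'rV[R]_n) k m :
  has_dim A k -> has_dim A m -> k = m.
Proof.
move=> [x0 [U [<- AU]]] [x1 [V [<-]]]; rewrite AU => UV.
by apply/eqP; rewrite eqn_leq; apply/andP; split; apply: mxrankS;
  [apply: (@flat_sub _ x0 x1 U V _).1|apply: (@flat_sub _ x1 x0 V U _).1];
  rewrite UV.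
Qed.

Lemma same_dim_aff_hull n (A B : set 'rV[R]_n) k :
  has_dim A k -> has_dim B k -> A `<=` B -> aff_hull B `<=` aff_hull A.
Proof.
move=> [x0 [U [rU AU]]] [x1 [V [rV BV]]] /aff_hullS; rewrite AU BV.
move=> /flat_sub[UV x01] x /= xV.
have VU : (V <= U)%MS by rewrite -(geq_leqif (mxrank_leqif_sup UV)) rU rV.
rewrite -[x](subrK x1) -addrA -[x1 - x0]opprB addmx_sub ?eqmx_opp//.
  exact: submx_trans VU.
exact: submx_trans VU.
Qed.

Lemma facet_functional_neq0 n (P : set 'rV[R]_n) k m a b :
  has_dim P k -> has_dim (P `&` [set x | dotv a x = b]) m -> k != m -> a != 0.
Proof.
move=> Pk Fm; apply: contra_neq => a0.
have [x [_ /= xb]] := has_dim_nonempty Fm.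
apply: has_dim_uniq Pk _.
move: Fm; rewrite (_ : P `&` _ = P)//; apply/seteqP; split=> y; first by case.
by move=> Py; split=> //=; rewrite -xb a0 !dotv0l.
Qed.

(** [F] and [G] have the same affine hull, which lies in the hyperplane that cuts [F] out of [P];
    hence [G] is contained in [F]. *)
Lemma facet_sub_eq n (P F G : set 'rV[R]_n) k :
  is_face P F -> is_face P G -> has_dim F k -> has_dim G k -> F `<=` G -> F = G.
Proof.
move=> [a [b [Pb FE]]] PG Fk Gk FG; apply/seteqP; split => // x Gx.
rewrite FE; split; first exact: face_sub PG _ Gx.
apply: (@aff_hull_hyperplane _ F); first by rewrite FE => y [].
by apply: (same_dim_aff_hull Fk Gk FG); exact: sub_aff_hull.
Qed.

End AffineDimension.

(** * Affine coordinates on a flat *)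

Section AffineEmbedding.
Context {R : realType}.

Definition emb n d (p0 : 'rV[R]_n) (B : 'M[R]_(d, n)) (y : 'rV[R]_d) := p0 + y *m B.
(** An affine map on the whole space, not only on the flat, so that preimages of Borel sets under it
    are Borel. It inverts [emb] when the rows of [B] are independent. *)
Definition chart n d (p0 : 'rV[R]_n) (B : 'M[R]_(d, n)) (x : 'rV[R]_n) :=
  (x - p0) *m pinvmx B.

Variables (n d : nat) (p0 : 'rV[R]_n) (B : 'M[R]_(d, n)).
Hypothesis fB : row_free B.
Local Notation iota := (emb p0 B).
Local Notation pi := (chart p0 B).

Lemma embK : cancel iota pi.
Proof. by move=> y; rewrite /chart /emb addrC addKr -mulmxA mulmxVp// mulmx1. Qed.

Lemma chartK x : (x - p0 <= B)%MS -> iota (pi x) = x.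
Proof. by move=> xB; rewrite /chart /emb mulmxKpV// subrKC. Qed.

Lemma emb_sub y : (iota y - p0 <= B)%MS.
Proof. by rewrite /emb addrC addKr submxMl. Qed.

Lemma emb_comb (I : finType) (w : I -> R) (p : I -> 'rV[R]_d) : \sum_i w i = 1 ->
  iota (\sum_i w i *: p i) = \sum_i w i *: iota (p i).
Proof.
move=> w1; rewrite /emb; under [RHS]eq_bigr do rewrite scalerDr.
rewrite big_split/= -scaler_suml w1 scale1r mulmx_suml; congr (_ + _).
by apply: eq_bigr => i _; rewrite scalemxAl.
Qed.

Lemma chart_comb (I : finType) (w : I -> R) (p : I -> 'rV[R]_n) : \sum_i w i = 1 ->
  pi (\sum_i w i *: p i) = \sum_i w i *: pi (p i).
Proof.
move=> w1; rewrite /chart -{1}[p0]scale1r -{1}w1 scaler_suml -sumrB mulmx_suml.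
by apply: eq_bigr => i _; rewrite -scalerBr scalemxAl.
Qed.

Lemma emb_conv_hull (I : finType) (p : I -> 'rV[R]_d) :
  iota @` conv_hull (range p) = conv_hull (range (iota \o p)).
Proof.
rewrite !conv_hull_rangeE; apply/seteqP; split=> x.
  by move=> [_ [w [w0 w1 ->]] <-]; exists w; split=> //; rewrite emb_comb.
move=> [w [w0 w1 ->]]; exists (\sum_i w i *: p i); first by exists w.
by rewrite emb_comb.
Qed.

Lemma chart_conv_hull (I : finType) (p : I -> 'rV[R]_n) :
  pi @` conv_hull (range p) = conv_hull (range (pi \o p)).
Proof.
rewrite !conv_hull_rangeE; apply/seteqP; split=> x.
  by move=> [_ [w [w0 w1 ->]] <-]; exists w; split=> //; rewrite chart_comb.
move=> [w [w0 w1 ->]]; exists (\sum_i w i *: p i); first by exists w.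
by rewrite chart_comb.
Qed.

Lemma emb_aff_hull (A : set 'rV[R]_d) : aff_hull (iota @` A) = iota @` aff_hull A.
Proof.
apply/seteqP; split=> x.
  move=> [k [p [w [Ap w1 ->]]]].
  exists (\sum_i w i *: pi (p i)).
    exists k, (pi \o p), w; split=> // i /=.
    by have [y Ay <-] := Ap i; rewrite embK.
  rewrite emb_comb//; apply: eq_bigr => i _; congr (_ *: _).
  by have [y Ay <-] := Ap i; rewrite embK.
move=> [_ [k [p [w [Ap w1 ->]]]] <-]; exists k, (iota \o p), w; split=> //.
  by move=> i; exists (p i).
by rewrite emb_comb.
Qed.

Lemma chart_aff_hull (A : set 'rV[R]_n) : aff_hull (pi @` A) = pi @` aff_hull A.
Proof.
apply/seteqP; split=> x.
  move=> [k [p [w [Ap w1 ->]]]].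
  have /choice[q qP] : forall i, exists q, A q /\ pi q = p i.
    by move=> i; have [q ? ?] := Ap i; exists q.
  exists (\sum_i w i *: q i).
    by exists k, q, w; split=> // i; have [] := qP i.
  by rewrite chart_comb//; apply: eq_bigr => i _; have [_ ->] := qP i.
move=> [_ [k [p [w [Ap w1 ->]]]] <-]; exists k, (pi \o p), w; split=> //.
  by move=> i; exists (p i).
by rewrite chart_comb.
Qed.

Lemma emb_has_dim (A : set 'rV[R]_d) k : has_dim A k -> has_dim (iota @` A) k.
Proof.
move=> [y0 [U [<- AU]]]; exists (iota y0), <<U *m B>>%MS; split.
  by rewrite genmxE mxrankMfree.
rewrite emb_aff_hull AU; apply/seteqP; split=> x /=.
  move=> [y yU <-]; rewrite genmxE /emb opprD addrACA subrr add0r -mulmxBl.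
  exact: submxMr.
rewrite genmxE => xU.
have xB : (x - p0 <= B)%MS.
  rewrite -[x](subrK (iota y0)) -addrA addmx_sub//; last exact: emb_sub.
  by apply: submx_trans xU _; exact: submxMl.
exists (pi x); last exact: chartK.
rewrite -(submxMfree _ _ fB) mulmxBl.
by move: xU; rewrite -{1}(chartK xB) /emb opprD addrACA subrr add0r.
Qed.

Lemma chart_has_dim (A : set 'rV[R]_n) k :
  (forall x, A x -> (x - p0 <= B)%MS) -> has_dim A k -> has_dim (pi @` A) k.
Proof.
move=> AB [x0 [U [<- AU]]].
have affB x : aff_hull A x -> (x - p0 <= B)%MS.
  move=> [m [p [w [Ap w1 ->]]]].
  rewrite -[p0]scale1r -w1 scaler_suml -sumrB; apply: summx_sub => i _.
  by rewrite -scalerBr scalemx_sub// AB.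
have x0B : (x0 - p0 <= B)%MS by apply: affB; rewrite AU /= subrr sub0mx.
have UB : (U <= B)%MS.
  apply/row_subP => i.
  have : (row i U + x0 - p0 <= B)%MS by apply: affB; rewrite AU /= addrK row_sub.
  rewrite -addrA => /submx_trans H; rewrite -[row i U](addrK (x0 - p0)).
  by rewrite addmx_sub ?eqmx_opp// H.
exists (pi x0), <<U *m pinvmx B>>%MS; split.
  by rewrite genmxE -(mxrankMfree _ fB) mulmxKpV.
rewrite chart_aff_hull AU; apply/seteqP; split=> y /=.
  move=> [x xU <-]; rewrite genmxE /chart -mulmxBl opprB addrA subrK.
  exact: submxMr.
rewrite genmxE => yU; exists (iota y); last exact: embK.
move: yU; rewrite -(submxMfree _ _ fB) mulmxBl mulmxKpV// mulmxKpV//.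
by rewrite opprB addrCA /emb addrA.
Qed.

Lemma emb_is_face (Q G : set 'rV[R]_d) : is_face Q G -> is_face (iota @` Q) (iota @` G).
Proof.
move=> [a [b [Qb ->]]].
have E y : dotv (a *m (pinvmx B)^T) (iota y) = dotv a y + dotv (a *m (pinvmx B)^T) p0.
  by rewrite -[in dotv a y](embK y) /chart dotv_mulmxr dotvBr subrK.
exists (a *m (pinvmx B)^T), (b + dotv (a *m (pinvmx B)^T) p0); split.
  by move=> _ [y Qy <-]; rewrite E lerD2r Qb.
apply/seteqP; split=> [_ [y [Qy /= yb] <-]|_ [[y Qy <-] /=]].
  by split; [exists y|rewrite /= E yb].
by rewrite E => /addIr yb; exists y.
Qed.

Lemma chart_is_face (P F : set 'rV[R]_n) :
  (forall x, P x -> (x - p0 <= B)%MS) -> is_face P F -> is_face (pi @` P) (pi @` F).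
Proof.
move=> PB [a [b [Pb ->]]].
have E x : P x -> dotv (a *m B^T) (pi x) = dotv a x - dotv a p0.
  by move=> /PB xB; rewrite -dotv_mulmxr -dotvBr -[in RHS](chartK xB) /emb addrC addKr.
exists (a *m B^T), (b - dotv a p0); split.
  by move=> _ [x Px <-]; rewrite E// lerD2r Pb.
apply/seteqP; split=> [_ [x [Px /= xb] <-]|_ [[x Px <-] /=]].
  by split; [exists x|rewrite /= E// xb].
by rewrite E// => /addIr xb; exists x.
Qed.

End AffineEmbedding.

(** * Frames and boundary points of facets *)

Section Facets.
Context {R : realType}.

(** The differences of the generators from one of them span the direction of the affine hull, so [d]
    of them form a basis. Choosing basis vectors among differences of points of [F] puts a whole
    coordinate simplex inside [F]. *)
Lemma facet_frame n d (F : set 'rV[R]_n) : is_polytope F -> has_dim F d ->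
  exists (p0 : 'rV[R]_n) (B : 'M[R]_(d, n)), [/\ row_free B, F p0,
    forall x, F x -> (x - p0 <= B)%MS & forall i, F (p0 + row i B)].
Proof.
move=> /polytopeP[k [q FE]] Fd.
have Fq i : F (q i) by rewrite FE; apply: sub_conv_hull; exists i.
have [i0] : exists i0 : 'I_k, True.
  have [x] := has_dim_nonempty Fd; rewrite FE conv_hull_rangeE => -[w [_ w1 _]].
  case: k q FE Fq w w1 => [|k] q FE Fq w w1; last by exists ord0.
  by move: w1; rewrite big_ord0 => /eqP; rewrite eq_sym oner_eq0.
move=> _; pose M := \matrix_i (q i - q i0).
have FM x : F x -> (x - q i0 <= M)%MS.
  rewrite FE conv_hull_rangeE => -[w [w0 w1 ->]].
  rewrite -[q i0]scale1r -w1 scaler_suml -sumrB; apply: summx_sub => i _.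
  by rewrite -scalerBr scalemx_sub// -(rowK (fun i => q i - q i0)) row_sub.
have [x0 [U [rU FU]]] := Fd.
have Ux x : F x -> (x - x0 <= U)%MS.
  by move=> Fx; have := sub_aff_hull Fx; rewrite FU.
have MU : (M <= U)%MS.
  apply/row_subP => i; rewrite rowK -[q i](subrK x0) -addrA -[x0 - _]opprB.
  by rewrite addmx_sub ?eqmx_opp ?Ux.
have UM : (U <= M)%MS.
  apply/row_subP => i.
  have affM x : aff_hull F x -> (x - q i0 <= M)%MS.
    move=> [m [p [w [Fp w1 ->]]]].
    rewrite -[q i0]scale1r -w1 scaler_suml -sumrB; apply: summx_sub => j _.
    by rewrite -scalerBr scalemx_sub// FM.
  have : aff_hull F (row i U + x0) by rewrite FU /= addrK row_sub.
  move=> /affM; rewrite -addrA => H; rewrite -[row i U](addrK (x0 - q i0)).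
  rewrite addmx_sub// eqmx_opp; apply: affM.
  by rewrite FU /= subrr sub0mx.
have rM : \rank M = d by rewrite -rU; apply/eqP; rewrite eqn_leq !mxrankS.
(* [d] is replaced by the rank of [M], because [maxrankfun] indexes a maximal free family of rows by
   that rank. *)
move: Fd rU; rewrite -rM => Fd rU.
exists (q i0), (rowsub (maxrankfun M) M); split => //.
- exact: maxrowsub_free.
- by move=> x /FM; rewrite eq_maxrowsub.
- by move=> i; rewrite row_rowsub rowK subrKC.
Qed.

(** The index [None] stands for the vertex [p0] and carries the weight left over by the
    coordinates. *)
Lemma frame_simplex n d (F : set 'rV[R]_n) (p0 : 'rV[R]_n) (B : 'M[R]_(d, n))
    (y : 'rV[R]_d) :
  is_polytope F -> F p0 -> (forall i, F (p0 + row i B)) ->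
  (forall i, 0 <= y 0 i) -> \sum_i y 0 i <= 1 -> F (emb p0 B y).
Proof.
move=> /polytopeP[k [q FE]] Fp0 FB y0 y1.
have cF : @convex_set R 'rV[R]_n F by apply/convex_setP; rewrite FE; exact: conv_hull_convex.
pose p (i : option 'I_d) := if i is Some i then p0 + row i B else p0.
pose w (i : option 'I_d) := if i is Some i then y 0 i else 1 - \sum_i y 0 i.
have wE (V : zmodType) (f : option 'I_d -> V) :
    \sum_i f i = f None + \sum_i f (Some i).
  rewrite (bigD1 None)//=; congr (_ + _).
  rewrite (reindex_omap Some id)/=; last by case.
  by apply: eq_bigl => i; rewrite eqxx.
have -> : emb p0 B y = \sum_i w i *: p i.
  rewrite wE /w /p /= /emb mulmx_sum_row.
  have -> : \sum_i y 0 i *: (p0 + row i B) =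
      (\sum_i y 0 i) *: p0 + \sum_i y 0 i *: row i B.
    by rewrite scaler_suml -big_split/=; apply: eq_bigr => i _; rewrite scalerDr.
  by rewrite addrA -scalerDl subrK scale1r.
apply: (@convex_comb _ _ _ p F w) => //.
- by case=> [i|]/=; rewrite ?subr_ge0.
- by case=> [i|]/= _.
- by rewrite wE /= subrK.
Qed.

Lemma face_polytope n (P F : set 'rV[R]_n) :
  is_polytope P -> is_face P F -> is_polytope F.
Proof.
move=> /polytopeP[k [p ->]] /face_conv_hull[J -> _].
exact: is_polytope_image.
Qed.

(** A small step from [x] in the direction [a] raises the functional above [b], so [x] is not
    interior. *)
Lemma nonzero_functional_boundary n (P : set 'rV[R]_n) a b x : a != 0 ->
  (forall x, P x -> dotv a x <= b) -> P x -> dotv a x = b -> boundary P x.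
Proof.
move=> a0 Pb Px xb; split; first exact: subset_closure.
move=> /= Pnx.
have ct : (fun t : R => x + t *: a) @ 0 --> x.
  have {2}-> : x = x + 0 *: a by rewrite scale0r addr0.
  by apply: cvgD; [exact: cvg_cst|apply: cvgZl; exact: cvg_id].
have /nbhs_ballP[e /= e0 eP] := ct _ Pnx.
have : P (x + (e / 2) *: a).
  apply: (eP (e / 2)); rewrite -ball_normE /= sub0r normrN gtr0_norm ?divr_gt0//.
  by rewrite ltr_pdivrMr// ltr_pMr// ltr1n.
move=> /Pb; rewrite dotvDr dotvZr xb gerDl leNgt mulr_gt0 ?divr_gt0//.
rewrite lt_neqAle dotv_ge0 andbT eq_sym; apply: contra_neq a0 => /dotv_eq0 //.
Qed.

End Facets.

(** * Counting flags and faces *)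

Section Counting.
Context {R : realType}.

Lemma size_le_sum_fibers (T U : eqType) (s : seq T) (g : T -> U) (r : seq U)
    (m : U -> nat) :
  (forall x, x \in s -> g x \in r) ->
  (forall u, u \in r -> count (fun x => g x == u) s <= m u)%N ->
  (size s <= \sum_(u <- r) m u)%N.
Proof.
move=> gr gm; apply: (@leq_trans (\sum_(u <- r) count (fun x => g x == u) s)).
  under eq_bigr do rewrite -sum1_count big_mkcond/=.
  rewrite exchange_big/= -sum1_size big_seq [leqRHS]big_seq; apply: leq_sum => x xs.
  by rewrite (big_rem (g x)) ?gr//= eqxx leq_addr.
by rewrite big_seq [leqRHS]big_seq; apply: leq_sum.
Qed.

Lemma sum_count_le_size (T U : eqType) (s : seq T) (r : seq U) (D : T -> U -> bool) :
  uniq r ->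
  (forall x u v, x \in s -> u \in r -> v \in r -> D x u -> D x v -> u = v) ->
  (\sum_(u <- r) count (D^~ u) s <= size s)%N.
Proof.
move=> ur Duv; under eq_bigr do rewrite -sum1_count big_mkcond/=.
rewrite exchange_big/= -sum1_size big_seq [leqRHS]big_seq; apply: leq_sum => x xs.
rewrite -big_mkcond sum1_count.
case: (boolP (has (D x) r)) => [/hasP[u ur' Du]|]; last first.
  by rewrite has_count -leqNgt leqn0 => /eqP ->.
apply: (@leq_trans (count_mem u r)); last by rewrite count_uniq_mem// leq_b1.
apply/eq_leq/eq_in_count => v vr /=; apply/idP/eqP => [Dv|->//].
exact: Duv Dv Du.
Qed.

(** Every face is the hull of some of the generators, so a flag is determined by finitely many
    finite sets. Finiteness matters because [fset_set] of an infinite set is empty. *)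
Lemma finite_flags n (P : set 'rV[R]_n) : is_polytope P ->
  finite_set [set F : {ffun 'I_n -> set 'rV[R]_n} |
      (forall i : 'I_n, is_face P (F i) /\ has_dim (F i) i) /\
      (forall i j : 'I_n, (i < j)%N -> F i `<` F j)].
Proof.
move=> /polytopeP[k [p PE]].
apply: (@sub_finite_set _ _ ((fun J : {ffun 'I_n -> {set 'I_k}} =>
   [ffun i => conv_hull (p @` [set` J i])]) @` setT)); last first.
  by apply: finite_image; exact: finite_finset.
move=> F [Ff _].
have /choice[J JP] : forall i, exists J : {set 'I_k}, F i = conv_hull (p @` [set` J]).
  by move=> i; have [] := Ff i; rewrite PE => /face_conv_hull[J ? _] _; exists J.
by exists [ffun i => J i] => //; apply/ffunP => i; rewrite !ffunE.
Qed.

(** Flags are grouped by their last member, a facet [F]. The chart carries the other members to a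
    flag of [Q F] and [emb] recovers them, so this map is injective on each group. The lower bound
    on the face numbers needs the inequality in this direction. *)
Lemma nflags_le_facets d (P : set 'rV[R]_d.+1)
    (Q : set 'rV[R]_d.+1 -> set 'rV[R]_d) : is_polytope P ->
  (forall F, is_face P F -> has_dim F d -> is_polytope (Q F) /\
     exists p0 (B : 'M[R]_(d, d.+1)),
     [/\ row_free B, forall x, F x -> (x - p0 <= B)%MS & Q F = chart p0 B @` F]) ->
  (nflags P <= \sum_(F <- fset_set [set F | is_face P F /\ has_dim F d])
     nflags (Q F))%N.
Proof.
move=> Pp QP; rewrite {1}/nflags.
set S' := [set F | _]; set S := [set F : set _ | _].
have fS' : finite_set S' by exact: finite_flags.
have fS : finite_set S.
  by apply: sub_finite_set (finite_faces Pp) => F [].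
apply: (@size_le_sum_fibers _ _ (fset_set S')
    (fun F : {ffun 'I_d.+1 -> set 'rV[R]_d.+1} => F ord_max)) => [f|F].
  rewrite !in_fset_set// !inE => -[/(_ ord_max)[? ?] _]; split => //.
rewrite in_fset_set// inE => -[PF Fd].
have [QFp [p0 [B [fB FB QE]]]] := QP F PF Fd.
rewrite -size_filter.
set s := seq.filter _ _.
have sP (f : {ffun 'I_d.+1 -> set 'rV[R]_d.+1}) : f \in s -> S' f /\ f ord_max = F.
  rewrite mem_filter => /andP[/eqP ?]; rewrite in_fset_set// inE => //.
have sF (f : {ffun 'I_d.+1 -> set 'rV[R]_d.+1}) i : f \in s -> f i `<=` F.
  move=> /sP[[_ fc] <-]; have [/fc []//|] := ltnP i (@ord_max d).
  by move=> di; rewrite (_ : i = ord_max)//; apply/val_inj/eqP; rewrite eqn_leq di -ltnS ltn_ord.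
have fB' (A : set 'rV[R]_d.+1) : A `<=` F ->
    emb p0 B @` (chart p0 B @` A) = A.
  move=> AF; rewrite image_comp; apply/seteqP; split=> x.
    by move=> [y Ay <-] /=; rewrite chartK//; apply: FB; exact: AF.
  by move=> Ax; exists x => //=; rewrite chartK//; apply: FB; exact: AF.
pose g (f : {ffun 'I_d.+1 -> set 'rV[R]_d.+1}) : {ffun 'I_d -> set 'rV[R]_d} :=
  [ffun i : 'I_d => chart p0 B @` f (widen_ord (leqnSn d) i)].
rewrite -(size_map g).
apply: uniq_leq_size.
  rewrite map_inj_in_uniq ?filter_uniq ?fset_uniq// => f f' fs fs' /ffunP gf.
  apply/ffunP => i; have [id|] := ltnP i d.
    have := gf (Ordinal id); rewrite !ffunE.
    rewrite (_ : widen_ord _ _ = i); last exact/val_inj.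
    by move=> /(congr1 (image^~ (emb p0 B))); rewrite !fB'//; exact: sF.
  move=> di; rewrite (_ : i = ord_max); last first.
    by apply/val_inj/eqP; rewrite eqn_leq di -ltnS ltn_ord.
  by rewrite (sP _ fs).2 (sP _ fs').2.
move=> _ /mapP[f fs ->]; rewrite in_fset_set; last exact: finite_flags.
have [[ff fc] fF] := sP _ fs.
rewrite inE; split=> [i|i j ij]; rewrite !ffunE.
  have [fi fid] := ff (widen_ord (leqnSn d) i); split; last first.
    by apply: chart_has_dim => // x /(sF _ _ fs); exact: FB.
  rewrite QE; apply: chart_is_face => //.
  (* The functional that cuts the member out of [P] also cuts it out of [F]. *)
  have [a [b [Pb fE]]] := fi; exists a, b; split.
    by move=> x Fx; apply: Pb; exact: face_sub PF _ Fx.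
  rewrite fE; apply/seteqP; split=> x [].
    move=> Px xb; split=> //; apply: (sF f (widen_ord (leqnSn d) i) fs).
    by rewrite fE.
  by move=> Fx xb; split=> //; exact: face_sub PF _ Fx.
have [fij /= fji] := fc (widen_ord (leqnSn d) i) (widen_ord (leqnSn d) j) ij.
split; first by move=> _ [x fx <-]; exists x => //; exact: fij.
move=> H; apply: fji.
rewrite -(fB' (f (widen_ord (leqnSn d) j))); last exact: sF.
rewrite -(fB' (f (widen_ord (leqnSn d) i))); last exact: sF.
exact: image_subset.
Qed.

End Counting.

Section SampleFaces.
Context {R : realType}.

Lemma conv_hull_sub n (P A : set 'rV[R]_n) :
  is_polytope P -> A `<=` P -> conv_hull A `<=` P.
Proof.
move=> [V _ ->] AP; apply: smallest_sub => //; apply/convex_setP.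
exact: conv_hull_convex.
Qed.

Lemma chart_emb_image n d (p0 : 'rV[R]_n) (B : 'M[R]_(d, n)) (A : set 'rV[R]_d) :
  row_free B -> chart p0 B @` (emb p0 B @` A) = A.
Proof.
move=> fB; rewrite image_comp; apply/seteqP; split=> x.
  by move=> [y Ay <-] /=; rewrite embK.
by move=> Ax; exists x => //=; rewrite embK.
Qed.

(** [e] enumerates the sample points on the supporting hyperplane. All points lie in [P], so this
    hyperplane also supports their hull and cuts out of it the hull of the enumerated points; faces
    of that face are faces of the whole hull by [face_trans]. *)
Lemma nfaces_chart_le n d N k l (P : set 'rV[R]_n) (a p0 : 'rV[R]_n) b
    (B : 'M[R]_(d, n)) (x : 'I_N -> 'rV[R]_n) (e : 'I_k -> 'I_N) :
  is_polytope P -> (forall x, P x -> dotv a x <= b) -> row_free B ->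
  (forall x, (P `&` [set x | dotv a x = b]) x -> (x - p0 <= B)%MS) ->
  (forall i, P (x i)) ->
  (forall i, dotv a (x i) = b <-> exists j, e j = i) ->
  (nfaces l (conv_hull (range (chart p0 B \o x \o e))) <=
   count (fun G => `[< G `<=` P `&` [set x | dotv a x = b] >])
     (fset_set [set G | is_face (conv_hull (range x)) G /\ has_dim G l]))%N.
Proof.
move=> Pp Pb fB FB Px xe.
have Pp' : is_polytope (conv_hull (range x)) by exact: is_polytope_range.
have PP' : conv_hull (range x) `<=` P.
  by apply: conv_hull_sub => // _ [i _ <-].
have QF : emb p0 B @` conv_hull (range (chart p0 B \o x \o e)) =
    conv_hull (range x) `&` [set y | dotv a y = b].
  rewrite emb_conv_hull face_conv => [|i]; last exact: Pb.
  congr conv_hull; apply/seteqP; split=> y.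
    move=> [j _ <-] /=; exists (e j); first by apply/eqP/xe; exists j.
    rewrite chartK//; apply: FB; split=> //=; apply/xe; by exists j.
  move=> [i /= /eqP xib <-]; have [j <-] := (xe i).1 xib; exists j => //=.
  rewrite chartK//; apply: FB; split=> //=; apply/xe; by exists j.
have fin m (p : 'I_m -> 'rV[R]_n) :
    finite_set [set G | is_face (conv_hull (range p)) G /\ has_dim G l].
  by apply: sub_finite_set (finite_faces (is_polytope_range p)) => F [].
have fin' m (p : 'I_m -> 'rV[R]_d) :
    finite_set [set G | is_face (conv_hull (range p)) G /\ has_dim G l].
  by apply: sub_finite_set (finite_faces (is_polytope_range p)) => F [].
rewrite /nfaces -size_filter -(size_map (image^~ (emb p0 B))).
apply: uniq_leq_size.
  rewrite map_inj_uniq ?fset_uniq// => G G' /(congr1 (image^~ (chart p0 B))).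
  by rewrite !chart_emb_image.
move=> _ /mapP[G + ->]; rewrite in_fset_set// inE => -[GQ Gl].
have GF : is_face (conv_hull (range x) `&` [set y | dotv a y = b]) (emb p0 B @` G).
  by rewrite -QF; exact: emb_is_face.
rewrite mem_filter in_fset_set//; apply/andP; split.
  apply/asboolP => y /(face_sub GF)[/PP' ? ?]; split => //.
rewrite inE; split; last exact: emb_has_dim.
apply: face_trans GF => //; exists a, b; split => // y /PP'; exact: Pb.
Qed.

(** Each [l]-face contains a sample point, and that point determines the only set of [r] that can
    contain the face. *)
Lemma sum_count_faces_le n N l (x : 'I_N -> 'rV[R]_n) (r : seq (set 'rV[R]_n)) :
  uniq r -> (forall i F G, F \in r -> G \in r -> F (x i) -> G (x i) -> F = G) ->
  (\sum_(F <- r) count (fun G => `[< G `<=` F >])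
     (fset_set [set G | is_face (conv_hull (range x)) G /\ has_dim G l])
   <= nfaces l (conv_hull (range x)))%N.
Proof.
move=> ur rx; apply: (sum_count_le_size (D := fun G F => `[< G `<=` F >])) => //.
move=> G F F'; rewrite in_fset_set; last first.
  by apply: sub_finite_set (finite_faces (is_polytope_range x)) => ? [].
rewrite inE => -[Gf Gl] Fr Fr' /asboolP GF /asboolP GF'.
have [i Gi] := face_has_vertex Gf (has_dim_nonempty Gl).
by apply: (rx i); [| |exact: GF|exact: GF'].
Qed.

End SampleFaces.

(** * Hausdorff and Lebesgue outer measures *)

Section CoverExt.
Context {R : realType} {T I : Type}.
Variables (tau : I -> \bar R) (S : I -> set T) (D : I -> Prop).
Hypothesis tau0 : forall i, (0 <= tau i)%E.
Local Open Scope ereal_scope.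

(** Common form of the Hausdorff premeasures at a fixed scale and of the Lebesgue outer measure:
    [tau] prices the pieces and [D] tells which ones are allowed. Countable subadditivity is then
    proved once. *)
Definition cover_ext (A : set T) : \bar R :=
  ereal_inf [set y | exists c : nat -> I,
    [/\ A `<=` \bigcup_k S (c k), forall k, D (c k)
      & y = \sum_(0 <= k <oo) tau (c k)]].

Lemma cover_ext_ge0 A : 0 <= cover_ext A.
Proof.
by apply: le_ereal_inf_tmp => y [c [_ _ ->]]; exact: nneseries_ge0.
Qed.

Lemma le_cover_ext A B : A `<=` B -> cover_ext A <= cover_ext B.
Proof.
move=> AB; apply: ereal_inf_le_tmp => y [c [Bc Dc ->]].
by exists c; split => //; exact: subset_trans Bc.
Qed.

Lemma cover_ext_approx A (e : R) : (0 < e)%R -> cover_ext A < +oo ->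
  exists c : nat -> I, [/\ A `<=` \bigcup_k S (c k), forall k, D (c k)
      & \sum_(0 <= k <oo) tau (c k) <= cover_ext A + e%:E].
Proof.
move=> e0 Aoo.
have Afin : cover_ext A \is a fin_num by rewrite ge0_fin_numE// cover_ext_ge0.
have [y [c [Ac Dc ->]] yA] := lb_ereal_inf_adherent e0 Afin.
by exists c; split => //; exact: ltW.
Qed.

Lemma cover_ext_sigma_subadditive : sigma_subadditive cover_ext.
Proof.
move=> F; have [[i Fi]|Foo] := pselect (exists i, cover_ext (F i) = +oo).
  rewrite (eseries_pinfty _ _ Fi) ?leey// => n _.
  by rewrite -ltNye (lt_le_trans _ (cover_ext_ge0 _)).
apply/lee_addgt0Pr => e e0.
rewrite (le_trans _ (epsilon_trick xpredT _ (ltW e0)))//; last first.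
  by move=> n; exact: cover_ext_ge0.
have /choice[c cP] : forall n, exists c : nat -> I,
    [/\ F n `<=` \bigcup_k S (c k), forall k, D (c k)
      & \sum_(0 <= k <oo) tau (c k) <= cover_ext (F n) + (e / (2 ^ n.+1)%:R)%:E].
  move=> n; apply: cover_ext_approx; first by rewrite divr_gt0// ltr0n expn_gt0.
  by rewrite ltey; apply/eqP => Fn; apply: Foo; exists n.
apply: (@le_trans _ _ (\sum_(n <oo) \sum_(0 <= k <oo) tau (c n k))); last first.
  apply: lee_nneseries => [n _ _|n _]; last by have [] := cP n.
  exact: nneseries_ge0.
have /card_esym/ppcard_eqP[f] := card_nat2.
apply: ereal_inf_lbound; exists (fun k => c (f k).1 (f k).2); split.
- move=> x [n _ Fx]; have [/(_ x Fx)[k _ Sx] _ _] := cP n.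
  by exists (f^-1%FUN (n, k)) => //; rewrite invK ?inE.
- by move=> k; have [] := cP (f k).1.
rewrite [RHS]nneseries_esumT// [LHS]nneseries_esumT; last first.
  by move=> n; exact: nneseries_ge0.
under [LHS]eq_esum do rewrite nneseries_esumT//.
rewrite (esum_esum (J := fun=> setT) (a := fun n k => tau (c n k)))//.
rewrite (_ : setT `*`` _ = [set: nat * nat]); last by apply/seteqP; split.
by rewrite (reindex_esum setT setT f (fun p => tau (c p.1 p.2))).
Qed.

End CoverExt.

(** * Hausdorff measure under Lipschitz maps and homotheties *)

Section Hausdorff.
Local Notation edist := Defs.edist.
Context {R : realType}.
Local Open Scope ereal_scope.

Lemma ediam_ge0 n (A : set 'rV[R]_n) : 0 <= ediam A.
Proof. by apply: ereal_sup_ubound; left. Qed.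

Lemma edist_ediam n (A : set 'rV[R]_n) u v : A u -> A v -> (edist u v)%:E <= ediam A.
Proof. by move=> Au Av; apply: ereal_sup_ubound; right; exists u, v. Qed.

Lemma ediam0 n : ediam (@set0 'rV[R]_n) = 0.
Proof.
apply/eqP; rewrite eq_le ediam_ge0 andbT; apply: ge_ereal_sup => y [->//|].
by move=> [u [v []]].
Qed.

Lemma expe_ge0 (x : \bar R) n : 0 <= x -> 0 <= x ^+ n.
Proof. by move=> x0; elim: n => // n IH; rewrite expeS mule_ge0. Qed.

Lemma hausdorff_preE n s (delta : R) (A : set 'rV[R]_n) :
  hausdorff_pre s delta A =
  cover_ext (fun C : set 'rV[R]_n => ediam C ^+ s) id
    (fun C => ediam C <= delta%:E) A.
Proof. by []. Qed.

Let diam_ge0 n s (C : set 'rV[R]_n) : 0 <= ediam C ^+ s.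
Proof. by rewrite expe_ge0// ediam_ge0. Qed.

Lemma hausdorff_pre_le n s delta (A : set 'rV[R]_n) : (0 < delta)%R ->
  hausdorff_pre s delta A <= hausdorff s A.
Proof. by move=> d0; apply: ereal_sup_ubound; exists delta. Qed.

Lemma hausdorff_ge0 n s (A : set 'rV[R]_n) : 0 <= hausdorff s A.
Proof.
apply: le_trans (hausdorff_pre_le _ _ ltr01).
by rewrite hausdorff_preE cover_ext_ge0.
Qed.

Lemma hausdorff_set0 n s : hausdorff s.+1 (@set0 'rV[R]_n) = 0.
Proof.
apply/eqP; rewrite eq_le hausdorff_ge0 andbT; apply: ge_ereal_sup => _ [d d0 <-].
apply: ereal_inf_lbound; exists (fun=> set0); split => //.
  by move=> k; rewrite ediam0 lee_fin ltW.
by rewrite eseries0// => k _ _; rewrite ediam0 expeS mul0e.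
Qed.

Lemma le_hausdorff n s (A B : set 'rV[R]_n) :
  A `<=` B -> hausdorff s A <= hausdorff s B.
Proof.
move=> AB; apply: ge_ereal_sup => _ [d d0 <-].
apply: le_trans (hausdorff_pre_le _ _ d0).
by rewrite !hausdorff_preE le_cover_ext.
Qed.

Lemma hausdorff_sigma_subadditive n s : sigma_subadditive (@hausdorff R n s).
Proof.
move=> F; apply: ge_ereal_sup => _ [d d0 <-].
rewrite hausdorff_preE; apply: le_trans (cover_ext_sigma_subadditive _ _ _ F) _ => //.
apply: lee_nneseries => [k _ _|k _]; first exact: cover_ext_ge0.
exact: hausdorff_pre_le.
Qed.

Lemma ediam_lipschitz n m (f : 'rV[R]_n -> 'rV[R]_m) (L : R) (A : set 'rV[R]_n) :
  (0 <= L)%R -> (forall x y, edist (f x) (f y) <= L * edist x y)%R ->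
  ediam (f @` A) <= L%:E * ediam A.
Proof.
move=> L0 fL; apply: ge_ereal_sup => _ [->|[_ [_ [[x Ax <-] [y Ay <-] ->]]]].
  by rewrite mule_ge0// ediam_ge0.
apply: (@le_trans _ _ (L%:E * (edist x y)%:E)); first by rewrite -EFinM lee_fin.
by rewrite lee_wpmul2l// edist_ediam.
Qed.

Lemma expe_le (x y : \bar R) n : 0 <= x -> x <= y -> x ^+ n <= y ^+ n.
Proof.
move=> x0 xy; elim: n => // n IH; rewrite !expeS lee_pmul// expe_ge0//.
Qed.

Lemma expeM (L : R) (x : \bar R) n : (L%:E * x) ^+ n = (L ^+ n)%:E * x ^+ n.
Proof.
elim: n => [|n IH]; first by rewrite !expe0 mule1 expr0.
by rewrite !expeS IH exprS EFinM muleACA.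
Qed.

(** The image of a cover at scale [d / L] is a cover at scale [d], and each term grows at most by
    the factor [L ^+ s]. *)
Lemma hausdorff_lipschitz n m s (f : 'rV[R]_n -> 'rV[R]_m) (L : R)
    (A : set 'rV[R]_n) : (0 < L)%R ->
  (forall x y, edist (f x) (f y) <= L * edist x y)%R ->
  hausdorff s (f @` A) <= (L ^+ s)%:E * hausdorff s A.
Proof.
move=> L0 fL; apply: ge_ereal_sup => _ [d d0 <-].
have dL0 : (0 < d / L)%R by rewrite divr_gt0.
apply: (@le_trans _ _ ((L ^+ s)%:E * hausdorff_pre s (d / L) A)); last first.
  apply: lee_wpmul2l; first by rewrite lee_fin exprn_ge0// ltW.
  exact: hausdorff_pre_le.
rewrite -ereal_inf_pZl ?exprn_gt0//.
apply: le_ereal_inf_tmp => _ [_ [C [AC dC ->]] <-].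
rewrite -nneseriesZl; last by move=> *; exact: diam_ge0.
apply: (@le_trans _ _ (\sum_(0 <= k <oo) ediam (f @` C k) ^+ s)).
  apply: ereal_inf_lbound; exists (fun k => f @` C k); split => //.
    by move=> _ [x /AC[k _ Ck] <-]; exists k => //; exists x.
  move=> k; apply: le_trans (ediam_lipschitz _ (ltW L0) fL) _.
  apply: (@le_trans _ _ (L%:E * (d / L)%:E)).
    by rewrite lee_wpmul2l ?lee_fin ?(ltW L0).
  by rewrite -EFinM lee_fin mulrC divfK// gt_eqF.
apply: lee_nneseries => [k _ _|k _]; first exact: diam_ge0.
rewrite -expeM; apply: expe_le; first exact: ediam_ge0.
exact: ediam_lipschitz (ltW L0) fL.
Qed.

Lemma edist_homothety n (x y t : 'rV[R]_n) (L : R) : (0 <= L)%R ->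
  edist (L *: x + t)%R (L *: y + t)%R = (L * edist x y)%R.
Proof.
move=> L0; rewrite /edist opprD addrACA subrr addr0 -scalerBr dotvZl dotvZr.
by rewrite mulrA -expr2 sqrtrM ?sqr_ge0// sqrtr_sqr ger0_norm.
Qed.

(** A homothety and its inverse are Lipschitz with reciprocal constants, so the two inequalities
    match. *)
Lemma hausdorff_homothety n s (A : set 'rV[R]_n) (L : R) (t : 'rV[R]_n) : (0 < L)%R ->
  hausdorff s ((fun x => L *: x + t)%R @` A) = (L ^+ s)%:E * hausdorff s A.
Proof.
move=> L0; apply/eqP; rewrite eq_le; apply/andP; split.
  by apply: hausdorff_lipschitz => // x y; rewrite edist_homothety// ltW.
rewrite -lee_pdivlMl ?exprn_gt0// -exprVn.
set B := (_ @` A).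
have -> : A = (fun x => L^-1 *: x + - (L^-1 *: t))%R @` B.
  rewrite image_comp; apply/seteqP; split=> x.
    move=> Ax; exists x => //=.
    by rewrite scalerDr scalerA mulVf ?gt_eqF// scale1r addrK.
  move=> [y Ay <-] /=.
  by rewrite scalerDr scalerA mulVf ?gt_eqF// scale1r addrK.
apply: hausdorff_lipschitz; first by rewrite invr_gt0.
by move=> x y; rewrite edist_homothety// invr_ge0 ltW.
Qed.

End Hausdorff.

(** * Lebesgue outer measure and its additivity on Borel sets *)

Section LebesgueOuter.
Context {R : realType}.

Definition hobox n (a b : 'rV[R]_n) : set 'rV[R]_n :=
  [set x | forall i, a 0 i <= x 0 i < b 0 i].

Definition vol n (a b : 'rV[R]_n) : R := \prod_(i < n) (b 0 i - a 0 i).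

Lemma vol_ge0 n (a b : 'rV[R]_n) : (forall i, a 0 i <= b 0 i) -> 0 <= vol a b.
Proof. by move=> ab; apply: prodr_ge0 => i _; rewrite subr_ge0. Qed.

Local Open Scope ereal_scope.

(** Prices in a [cover_ext] must be nonnegative at every index, including pairs that are no box; the
    absolute value ensures this and changes nothing on admissible boxes. *)
Lemma lebesgue_rVE n : @lebesgue_rV R n =
  cover_ext (fun p : 'rV[R]_n * 'rV[R]_n => `|vol p.1 p.2|%:E)
    (fun p => hobox p.1 p.2) (fun p => forall i, p.1 0%R i <= p.2 0%R i)%R.
Proof.
apply/funext => A; congr ereal_inf; apply/seteqP; split=> y.
  move=> [a [b [ab Aab ->]]]; exists (fun k => (a k, b k)); split=> //.
  by apply: eq_eseriesr => k _; rewrite ger0_norm//; apply: vol_ge0 => i; exact: ab.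
move=> [c [Ac cP ->]]; exists (fun k => (c k).1), (fun k => (c k).2); split=> //.
by apply: eq_eseriesr => k _; rewrite ger0_norm//; apply: vol_ge0 => i; exact: cP.
Qed.

Lemma lebesgue_rV_ge0 n (A : set 'rV[R]_n) : 0 <= lebesgue_rV A.
Proof. by rewrite lebesgue_rVE cover_ext_ge0. Qed.

(** Empty boxes cost nothing only in positive dimension: in dimension 0 the volume is an empty
    product, equal to 1. Hence the [n.+1]. *)
Lemma lebesgue_rV0 n : @lebesgue_rV R n.+1 set0 = 0.
Proof.
apply/eqP; rewrite eq_le lebesgue_rV_ge0 andbT; apply: ereal_inf_lbound.
exists (fun=> 0%R), (fun=> 0%R); split=> //.
by rewrite eseries0// => k _ _; rewrite big_ord_recl subrr mul0r.
Qed.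

Lemma le_lebesgue_rV n : {homo @lebesgue_rV R n : A B / A `<=` B >-> A <= B}.
Proof. by move=> A B AB; rewrite lebesgue_rVE le_cover_ext. Qed.

Lemma lebesgue_rV_subadditive n : sigma_subadditive (@lebesgue_rV R n).
Proof. by rewrite lebesgue_rVE; exact: cover_ext_sigma_subadditive. Qed.

HB.instance Definition _ n := isOuterMeasure.Build R 'rV[R]_n.+1
  (@lebesgue_rV R n.+1) (@lebesgue_rV0 n) (@lebesgue_rV_ge0 n.+1)
  (@le_lebesgue_rV n.+1) (@lebesgue_rV_subadditive n.+1).

Lemma lebesgue_hobox_le n (a b : 'rV[R]_n.+1) : (forall i, a 0 i <= b 0 i)%R ->
  lebesgue_rV (hobox a b) <= (vol a b)%:E.
Proof.
move=> ab; apply: ereal_inf_lbound.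
exists (fun k => if k == 0%N then a else 0%R), (fun k => if k == 0%N then b else 0%R).
split; first by move=> [|k] i.
  by move=> x xab; exists 0%N.
rewrite nneseries_recl//; last first.
  move=> [|k] _; first by rewrite lee_fin vol_ge0.
  by rewrite lee_fin prodr_ge0// => i _; rewrite subrr.
rewrite eseries_cond/= eseries0 ?adde0// => -[//|k] _ _.
by rewrite big_ord_recl subrr mul0r.
Qed.

(** The hyperplane at height [t] cuts each box of a cover into two whose volumes add up to the old
    one. [c k] is [t] clamped to the [j]-th side, so that a box lying on one side leaves a
    degenerate half on the other. *)
Lemma halfspace_caratheodory n (j : 'I_n.+1) (t : R) :
  (@lebesgue_rV R n.+1).-caratheodory [set x | x 0 j < t]%R.
Proof.
apply: le_caratheodory_measurable => X.
apply: le_ereal_inf_tmp => _ [a [b [ab Xab ->]]].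
pose c k : R := (Num.max (a k 0 j) (Num.min (b k 0 j) t))%R.
have ac k : (a k 0 j <= c k)%R by rewrite /c le_max lexx.
have cb k : (c k <= b k 0 j)%R by rewrite /c ge_max ab ge_min lexx.
pose b' k : 'rV[R]_n.+1 := (\row_i if i == j then c k else b k 0 i)%R.
pose a' k : 'rV[R]_n.+1 := (\row_i if i == j then c k else a k 0 i)%R.
have ab' k i : (a k 0 i <= b' k 0 i)%R by rewrite mxE; case: eqP => [->|].
have a'b k i : (a' k 0 i <= b k 0 i)%R by rewrite mxE; case: eqP => [->|].
have volE k : (vol (a k) (b k) = vol (a k) (b' k) + vol (a' k) (b k))%R.
  have volD a0 b0 : (vol a0 b0 = (b0 0 j - a0 0 j) * \prod_(i < n.+1 | i != j) (b0 0 i - a0 0 i))%R.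
    by rewrite /vol (bigD1 j).
  rewrite !volD !mxE eqxx.
  rewrite [in X in (_ = _ * X + _)%R](eq_bigr (fun i => b k 0 i - a k 0 i)%R); last first.
    by move=> i /negPf ij; rewrite mxE ij.
  rewrite [in X in (_ = _ + _ * X)%R](eq_bigr (fun i => b k 0 i - a k 0 i)%R); last first.
    by move=> i /negPf ij; rewrite mxE ij.
  by rewrite -mulrDl; congr (_ * _)%R; ring.
under eq_eseriesr do rewrite -/(vol _ _) volE EFinD.
rewrite nneseriesD; last 2 first.
- by move=> k _ _; rewrite lee_fin vol_ge0.
- by move=> k _ _; rewrite lee_fin vol_ge0.
apply: leeD; apply: ereal_inf_lbound.
  exists a, b'; split=> // x [/Xab[k _ xk] /= xt]; exists k => // i.
  have /andP[ax xb] := xk i; rewrite ax mxE /=; case: eqP => // ij.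
  by rewrite /c lt_max lt_min -ij xb ij xt orbT.
exists a', b; split=> // x [/Xab[k _ xk] /negP]; rewrite /= -leNgt => tx; exists k => // i.
have /andP[ax xb] := xk i; rewrite xb andbT mxE; case: eqP => // ij.
by rewrite /c ge_max ge_min -ij ax ij tx orbT.
Qed.

Lemma hobox_caratheodory n (a b : 'rV[R]_n.+1) :
  (@lebesgue_rV R n.+1).-caratheodory (hobox a b).
Proof.
pose F (i : 'I_n.+1) := [set x : 'rV[R]_n.+1 | x 0 i < b 0 i]%R `&`
   ~` [set x | x 0 i < a 0 i]%R.
rewrite (_ : hobox a b = \bigcap_(i in [set` enum 'I_n.+1]) F i); last first.
  apply/seteqP; split=> x /= xab i.
    by move=> _; have /andP[ai bi] := xab i; split=> //=; apply/negP; rewrite -leNgt.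
  have [|/= xb] := xab i; first by rewrite /= mem_enum.
  by move=> /negP; rewrite -leNgt xb andbT.
rewrite bigcap_seq; elim/big_ind : _.
- by rewrite -setC0; exact/caratheodory_measurable_setC/caratheodory_measurable_set0.
- exact: caratheodory_measurable_setI.
- move=> i _; apply: caratheodory_measurable_setI; first exact: halfspace_caratheodory.
  apply: caratheodory_measurable_setC; exact: halfspace_caratheodory.
Qed.


End LebesgueOuter.

Section BorelCaratheodory.
Context {R : realType}.

Definition dyadic n (k : nat) (z : {ffun 'I_n -> int}) : set 'rV[R]_n :=
  hobox (\row_i ((z i)%:~R / 2 ^+ k)) (\row_i (((z i)%:~R + 1) / 2 ^+ k)).

(** Unpickling natural numbers lists all pairs of a scale and an integer vector, which makes the
    union of the dyadic cubes inside [U] countable. Numbers that code no pair, and cubes not inside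
    [U], contribute the empty set. *)
Lemma open_bigcup_dyadic n (U : set 'rV[R]_n) : open U ->
  U = \bigcup_m (if @choice.unpickle (nat * {ffun 'I_n -> int})%type m is Some (k, z) then
    if `[< @dyadic n k z `<=` U >] then dyadic k z else set0 else set0).
Proof.
move=> oU; apply/seteqP; split=> x; last first.
  move=> [m _]; case: choice.unpickle => [[k z]|//]; case: asboolP => // zU; exact: zU.
move=> Ux; have /nbhs_ballP[e /= e0 eU] : nbhs x U by exact: open_nbhs_nbhs.
have [k ke] : exists k : nat, (2 ^+ k)^-1 < e.
  exists (Num.truncn e^-1).+1; rewrite invf_plt ?posrE ?exprn_gt0//.
  apply: (lt_le_trans (truncnS_gt _)).
  by rewrite -natrX ler_nat ltnW// ltn_expl.
have k0 : 0 < 2 ^+ k :> R by rewrite exprn_gt0.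
pose z : {ffun 'I_n -> int} := [ffun i => Num.floor (x 0 i * 2 ^+ k)].
have zx : dyadic k z x.
  move=> i; rewrite !mxE ffunE ler_pdivrMr// ltr_pdivlMr//.
  by rewrite floor_le_tmp/= -intrD1 floorD1_gt.
exists (choice.pickle (k, z)) => //; rewrite choice.pickleK.
case: asboolP => // zU; exfalso; apply: zU => y zy; apply: eU.
split=> // i j; rewrite (ord1 i) -ball_normE /= ltr_norml.
have := zx j; have := zy j; rewrite !mxE mulrDl mul1r.
by move: ke; set u := (2 ^+ k)^-1; lra.
Qed.

(** Caratheodory sets form a sigma-algebra and contain the dyadic cubes, hence the open sets. *)
Lemma borel_caratheodory n (A : set (borel_rV R n.+1)) : measurable A ->
  (@lebesgue_rV R n.+1).-caratheodory A.
Proof.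
apply: smallest_sub; last first.
  move=> U oU; rewrite (open_bigcup_dyadic oU).
  apply: caratheodory_measurable_bigcup => m; case: choice.unpickle => [[k z]|].
    by case: ifP => _; [exact: hobox_caratheodory|exact: caratheodory_measurable_set0].
  exact: caratheodory_measurable_set0.
split.
- exact: caratheodory_measurable_set0.
- by move=> B cB; rewrite setTD; exact: caratheodory_measurable_setC.
- by move=> F cF; exact: caratheodory_measurable_bigcup.
Qed.

End BorelCaratheodory.

(** * Lower bound for the Lebesgue measure of a cube *)

Section LebesguePositive.
Context {R : realType}.

Lemma sum_nat_interval_le (M : nat) (u v : R) : u <= v ->
  (\sum_(j < M) (u <= j%:R < v)%R)%:R <= v - u + 1.
Proof.
move=> uv.
have [[j0 j0P]|no] := pselect (exists j : nat, u <= j%:R < v); last first.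
  rewrite big1 => [|j _]; first by rewrite addr_ge0// subr_ge0.
  by apply/eqP; rewrite eqb0; apply/negP => h; apply: no; exists j.
case: (ex_minnP (ex_intro (fun j : nat => u <= j%:R < v) j0 j0P)) => m /andP[um mv] mmin.
pose K := (Num.truncn (v - u)).+1.
have jK (j : nat) : u <= j%:R < v -> (m <= j < m + K)%N.
  move=> jP; have mj := mmin j jP; rewrite mj/=; move: jP => /andP[uj jv].
  rewrite -ltn_subLR// /K ltnS truncn_ge_nat ?subr_ge0// natrB//; lra.
apply: (@le_trans _ _ K%:R); last first.
  by rewrite /K -natr1 lerD2r truncn_le subr_ge0.
rewrite ler_nat -(big_mkord xpredT (fun j => (u <= j%:R < v)%R : nat)) -big_mkcond.
rewrite sum1_count -size_filter -[leqRHS](size_iota m); apply: uniq_leq_size.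
  by rewrite filter_uniq// iota_uniq.
by move=> j; rewrite mem_filter mem_iota => /andP[/jK].
Qed.

(* Counting the points of the grid [(r / M) Z^n] gives the bound up to the error [r / M]. *)
Lemma cube_cover_bound n (r : R) (I : finType) (J : pred I) (a b : I -> 'rV[R]_n) (M : nat) :
  0 < r -> (0 < M)%N -> (forall i, forall j, a i 0 j <= b i 0 j) ->
  (forall x : 'rV[R]_n, (forall j, 0 <= x 0 j <= r) ->
    exists2 i, J i & hobox (a i) (b i) x) ->
  r ^+ n <= \sum_(i | J i) \prod_j (b i 0 j - a i 0 j + r / M%:R).
Proof.
move=> r0 M0 ab cov; have MR0 : 0 < M%:R :> R by rewrite ltr0n.
have rM0 : 0 < r / M%:R by rewrite divr_gt0.
pose pt (f : {ffun 'I_n -> 'I_M}) : 'rV[R]_n := \row_j ((f j)%:R * (r / M%:R)).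
(* Indicator that the grid point [f] lies in box [i], written as a product over the coordinates so
   that its sum over [f] factors. *)
pose ins i (f : {ffun 'I_n -> 'I_M}) : R :=
  \prod_j ((a i 0 j / (r / M%:R) <= (f j)%:R < b i 0 j / (r / M%:R))%R)%:R.
have ins0 i f : 0 <= ins i f by apply: prodr_ge0.
have cov1 f : 1 <= \sum_(i | J i) ins i f.
  have [j|i Ji xi] := cov (pt f).
    rewrite mxE mulr_ge0 ?(ltW rM0)//= mulrA ler_pdivrMr// mulrC ler_wpM2l ?(ltW r0)//.
    by rewrite ler_nat ltnW.
  rewrite (bigD1 i)//= {1}/ins big1 ?lerDl ?sumr_ge0// => j _.
  by have := xi j; rewrite mxE ler_pdivrMr// ltr_pdivlMr// => ->.
have : (M ^ n)%:R <= \sum_(i | J i) \prod_j ((b i 0 j - a i 0 j) / (r / M%:R) + 1).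
  apply: (@le_trans _ _ (\sum_f \sum_(i | J i) ins i f)).
    apply: (@le_trans _ _ (\sum_(f : {ffun 'I_n -> 'I_M}) 1)); last exact: ler_sum.
    by rewrite sumr_const card_ffun !card_ord.
  rewrite exchange_big/=; apply: ler_sum => i _.
  rewrite -(bigA_distr_bigA (fun j (k : 'I_M) =>
    ((a i 0 j / (r / M%:R) <= k%:R < b i 0 j / (r / M%:R))%R)%:R : R)).
  apply: ler_prod => j _; rewrite sumr_ge0//= -natr_sum mulrBl.
  by apply: sum_nat_interval_le; rewrite ler_pM2r ?invr_gt0.
move=> H.
have -> : r ^+ n = (r / M%:R) ^+ n * (M ^ n)%:R.
  by rewrite natrX -exprMn divfK// gt_eqF.
apply: (le_trans (ler_wpM2l _ H)); first by rewrite exprn_ge0// ltW.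
rewrite mulr_sumr; apply: ler_sum => i _.
rewrite -{1}[n]card_ord -prodr_const -big_split/=; apply: ler_prod => j _.
have l0 : 0 <= b i 0 j - a i 0 j by rewrite subr_ge0.
apply/andP; split; last by rewrite mulrDr mulr1 mulrCA divff ?gt_eqF// mulr1.
by apply: mulr_ge0; [exact: ltW|rewrite addr_ge0// divr_ge0// ltW].
Qed.
Lemma prod_shift_continuous (I J : finType) (l : I -> J -> R) :
  continuous (fun t : R => \sum_i \prod_j (l i j + t)).
Proof.
move=> t; apply: continuous_big => [|i _ {}t]; first exact: add_continuous.
apply: continuous_big => [|j _ {}t]; first exact: mul_continuous.
by apply: cvgD; [exact: cvg_cst|exact: cvg_id].
Qed.

(** This removes the grid error [r / M], which takes arbitrarily small positive values. *)
Lemma continuous_le0 (g : R -> R) c : continuous g ->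
  (forall t, 0 < t -> exists2 s, 0 < s < t & c <= g s) -> c <= g 0.
Proof.
move=> gc H; apply/ler_addgt0Pr => e e0.
have /nbhs_ballP[t /= t0 te] : nbhs (0 : R) (g @^-1` ball (g 0) e).
  by apply: gc; exact: nbhsx_ballx.
have [s /andP[s0 st] cs] := H t t0.
have : ball (g 0) e (g s) by apply: te; rewrite -ball_normE /= sub0r normrN gtr0_norm.
by rewrite -ball_normE /= ltr_norml; lra.
Qed.

Lemma prod_shift_small (J : finType) (l : J -> R) e : 0 < e ->
  exists2 t, 0 < t & \prod_j (l j + t) <= \prod_j l j + e.
Proof.
move=> e0; pose g (t : R) := \sum_(i < 1) \prod_j (l j + t).
have gE t : g t = \prod_j (l j + t) by rewrite /g big_ord1.
have /nbhs_ballP[t /= t0 te] : nbhs (0 : R) (g @^-1` ball (g 0) e).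
  by apply: (@prod_shift_continuous _ _ (fun=> l)); exact: nbhsx_ballx.
exists (t / 2); first by rewrite divr_gt0.
have : ball (g 0) e (g (t / 2)).
  apply: te; rewrite -ball_normE /= sub0r normrN gtr0_norm ?divr_gt0//.
  by rewrite ltr_pdivrMr// ltr_pMr// ltr1n.
rewrite !gE -ball_normE /=; under eq_bigr do rewrite addr0.
by rewrite ltr_norml; lra.
Qed.

Lemma open_box n (a b : 'I_n -> R) :
  open [set x : 'rV[R]_n | forall j, a j < x 0 j < b j].
Proof.
rewrite openE => x /= xab.
exists (fun _ j => [set` `]a j, b j[]) => [i j|y yab j]; last first.
  by have := yab 0 j; rewrite /= in_itv.
by rewrite (ord1 i); apply: near_in_itvoo; rewrite in_itv/=; exact: xab.
Qed.

(** The half-open boxes of a cover are widened to open ones at total cost [e]; compactness leaves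
    finitely many, to which the grid count applies. *)
Lemma lebesgue_cube_ge n (r : R) : 0 < r ->
  ((r ^+ n)%:E <= lebesgue_rV [set x : 'rV[R]_n | forall j, (0 <= x 0 j <= r)%R])%E.
Proof.
move=> r0; apply: le_ereal_inf_tmp => _ [a [b [ab Xab ->]]].
apply/lee_addgt0Pr => e e0.
have /choice[t tP] : forall k, exists t : R, 0 < t /\
    \prod_j (b k 0 j - a k 0 j + t) <= vol (a k) (b k) + e / (2 ^ k.+1)%:R.
  move=> k; have ek : 0 < e / (2 ^ k.+1)%:R by rewrite divr_gt0// ltr0n expn_gt0.
  have [t t0 tP] := @prod_shift_small _ (fun j => b k 0 j - a k 0 j) _ ek.
  by exists t.
pose U k := [set x : 'rV[R]_n | forall j, a k 0 j - t k / 2 < x 0 j < b k 0 j + t k / 2].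
have t20 k : 0 < t k / 2 by rewrite divr_gt0// (tP k).1.
have oU k : open (U k) by exact: open_box.
have : compact [set x : 'rV[R]_n | forall j, (0 <= x 0 j <= r)%R].
  rewrite (_ : mkset _ = [set x : 'rV[R]_n | forall j, `[0, r]%classic (x 0 j)]).
    apply: (@rV_compact R n (fun=> `[0, r]%classic)) => i; exact: segment_compact.
  by apply/seteqP; split=> x /= + j => /(_ j); rewrite /= in_itv.
rewrite compact_cover => /(_ nat setT U (fun k _ => oU k)).
have : [set x : 'rV[R]_n | forall j, (0 <= x 0 j <= r)%R] `<=` \bigcup_(k in setT) U k.
  move=> x /Xab[k _ xk]; exists k => // j; have /andP[? ?] := xk j.
  by have := t20 k; lra.
move=> /[swap]/[apply] -[D _ DU].
have [K KD] : exists K, forall k, k \in D -> (k < K)%N.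
  by exists (\max_(k <- D) k).+1 => k kD; rewrite ltnS leq_bigmax_seq.
have main : r ^+ n <= \sum_(k < K) \prod_j (b k 0 j - a k 0 j + t k).
  have := @continuous_le0 _ (r ^+ n)
    (@prod_shift_continuous 'I_K 'I_n (fun k j => b k 0 j - a k 0 j + t k)).
  have -> : \sum_(k < K) \prod_j (b k 0 j - a k 0 j + t k + 0) =
      \sum_(k < K) \prod_j (b k 0 j - a k 0 j + t k).
    by apply: eq_bigr => k _; apply: eq_bigr => j _; rewrite addr0.
  apply=> s s0; pose M := (Num.truncn (r / s)).+1.
  have MR0 : 0 < M%:R :> R by rewrite ltr0n.
  exists (r / M%:R).
    rewrite divr_gt0//= ltr_pdivrMr// mulrC -ltr_pdivrMr//; exact: truncnS_gt.
  apply: (le_trans (@cube_cover_bound n r 'I_K xpredT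
    (fun k => \row_j (a k 0 j - t k / 2)) (fun k => \row_j (b k 0 j + t k / 2)) M r0 _ _ _)) => //.
  - by move=> k j; rewrite !mxE; have := ab k j; have := t20 k; lra.
  - move=> x xr; have [k /KD kK xk] := DU x xr.
    exists (Ordinal kK) => // j; have /andP[xl xu] := xk j.
    by rewrite !mxE /= xu ltW.
  - apply: ler_sum => k _; rewrite le_eqVlt; apply/orP; left; apply/eqP.
    by apply: eq_bigr => j _; rewrite !mxE; congr (_ + _); lra.
apply: (@le_trans _ _ (\sum_(k < K) (vol (a k) (b k) + e / (2 ^ k.+1)%:R))%:E).
  by rewrite lee_fin (le_trans main)//; apply: ler_sum => k _; have [] := tP k.
have v0 k : (0 <= (vol (a k) (b k))%:E)%E by rewrite lee_fin vol_ge0.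
apply: le_trans (epsilon_trick xpredT v0 (ltW e0)).
rewrite -sumEFin -(big_mkord xpredT (fun k => (vol (a k) (b k) + e / (2 ^ k.+1)%:R)%:E)).
apply: nneseries_lim_ge => k _ _.
by rewrite lee_fin addr_ge0 ?vol_ge0// divr_ge0// ltW.
Qed.

End LebesguePositive.

(** * Hausdorff against Lebesgue measure in affine coordinates *)

Section ChartMeasure.
Context {R : realType}.
Local Open Scope ereal_scope.
Local Notation edist := Defs.edist.

Lemma outer_measure_fin_cover (T : Type) (mu : {outer_measure set T -> \bar R})
    (I : finType) (A : set T) (F : I -> set T) :
  (forall x, A x -> exists i, F i x) -> mu A <= \sum_i mu (F i).
Proof.
move=> AF; apply: (@le_trans _ _ (mu (\big[setU/set0]_i F i))).
  apply: le_outer_measure => x /AF[i Fi]; rewrite -bigcup_seq.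
  by exists i => //=; rewrite mem_index_enum.
elim: (index_enum I) => [|i r IH]; first by rewrite !big_nil outer_measure0.
by rewrite !big_cons (le_trans (outer_measureU2 _ _ _))// leeD2l.
Qed.

Definition chart_measure n d (p0 : 'rV[R]_n) (B : 'M[R]_(d, n)) (A : set 'rV[R]_d) :=
  hausdorff d (emb p0 B @` A).

Lemma chart_measure0 n d p0 (B : 'M[R]_(d.+1, n)) : chart_measure p0 B set0 = 0.
Proof. by rewrite /chart_measure image_set0 hausdorff_set0. Qed.

Lemma chart_measure_ge0 n d p0 (B : 'M[R]_(d, n)) A : 0 <= chart_measure p0 B A.
Proof. exact: hausdorff_ge0. Qed.

Lemma le_chart_measure n d p0 (B : 'M[R]_(d, n)) :
  {homo chart_measure p0 B : A C / A `<=` C >-> A <= C}.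
Proof. by move=> A C AC; apply: le_hausdorff; exact: image_subset. Qed.

Lemma chart_measure_subadditive n d p0 (B : 'M[R]_(d, n)) :
  sigma_subadditive (chart_measure p0 B).
Proof.
move=> F; rewrite /chart_measure image_bigcup.
exact: (hausdorff_sigma_subadditive _ (fun k => emb p0 B @` F k)).
Qed.

HB.instance Definition _ n d p0 (B : 'M[R]_(d.+1, n)) :=
  isOuterMeasure.Build R 'rV[R]_d.+1 (chart_measure p0 B)
  (chart_measure0 p0 B) (chart_measure_ge0 p0 B)
  (@le_chart_measure _ _ p0 B) (@chart_measure_subadditive _ _ p0 B).

(** [emb] conjugates the homothety of the coordinate space to one of the ambient space with the same
    ratio and a suitable translation. *)
Lemma chart_measure_homothety n d p0 (B : 'M[R]_(d, n)) (L : R) t A : (0 < L)%R ->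
  chart_measure p0 B ((fun y => L *: y + t)%R @` A) = (L ^+ d)%:E * chart_measure p0 B A.
Proof.
move=> L0; rewrite /chart_measure.
rewrite -(@hausdorff_homothety _ _ _ _ _ (p0 + t *m B - L *: p0)%R L0).
congr hausdorff; rewrite !image_comp; apply: eq_imagel => y _ /=; rewrite /emb.
rewrite mulmxDl -scalemxAl; move: (y *m B)%R (t *m B)%R => u v.
by apply/rowP => i; rewrite !mxE; ring.
Qed.

Definition unit_box d : set 'rV[R]_d := hobox 0%R (const_mx 1%R).

Lemma hobox_homothety d (a : 'rV[R]_d) (L : R) : (0 < L)%R ->
  hobox a (\row_i (a 0%R i + L))%R = (fun y => L *: y + a)%R @` @unit_box d.
Proof.
move=> L0; apply/seteqP; split=> x.
  move=> xa; exists (L^-1 *: (x - a))%R; last first.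
    by rewrite scalerA divff ?gt_eqF// scale1r subrK.
  move=> i; have := xa i; rewrite !mxE => /andP[ax xb].
  rewrite mulr_ge0 ?invr_ge0 ?(ltW L0) ?subr_ge0//= mulrC ltr_pdivrMr// mul1r.
  by rewrite ltrBlDl.
move=> [y yu <-] i; have := yu i; rewrite !mxE => /andP[y0 y1].
by rewrite lerDr mulr_ge0 ?(ltW L0)//= addrC ltrD2l gtr_pMr.
Qed.

Section Comparison.
Local Open Scope ring_scope.
Variables (n d : nat) (p0 : 'rV[R]_n) (B : 'M[R]_(d.+1, n)).
Local Notation nu := (chart_measure p0 B).
Hypothesis nu_fin : (nu (@unit_box d.+1) < +oo)%E.
Let kappa : R := fine (nu (@unit_box d.+1)).

Let kappaE : nu (@unit_box d.+1) = kappa%:E.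
Proof. by rewrite /kappa fineK// ge0_fin_numE// chart_measure_ge0. Qed.

Let kappa0 : (0 <= kappa)%R.
Proof. by rewrite /kappa fine_ge0// chart_measure_ge0. Qed.

Let nu_cube (a : 'rV[R]_d.+1) (L : R) : (0 < L)%R ->
  nu (hobox a (\row_i (a 0%R i + L))%R) = (L ^+ d.+1 * kappa)%:E.
Proof.
by move=> L0; rewrite hobox_homothety// chart_measure_homothety// kappaE EFinM.
Qed.

(** The box is covered by a grid of cubes of side [e], each a homothetic copy of the unit box; along
    axis [j] the grid has length at most [b 0 j - a 0 j + e]. *)
Lemma chart_measure_hobox_eps (a b : 'rV[R]_d.+1) (e : R) : (0 < e)%R ->
  (forall i, a 0 i <= b 0 i)%R ->
  (nu (hobox a b) <= (kappa * \prod_j (b 0 j - a 0 j + e))%:E)%E.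
Proof.
move=> e0 ab.
pose m j := (Num.truncn ((b 0 j - a 0 j) / e)).+1.
(* A common bound for the [m j]: one function type then indexes the grid. Indices beyond [m j] get
   the empty set, and the sum factors over the axes. *)
pose M := (\sum_j m j)%N.
have mM j : (m j <= M)%N by rewrite /M (bigD1 j)//= leq_addr.
pose t (z : {ffun 'I_d.+1 -> 'I_M}) : 'rV[R]_d.+1 := (\row_j (a 0 j + e * (z j)%:R))%R.
pose S (z : {ffun 'I_d.+1 -> 'I_M}) :=
  if [forall j, (z j < m j)%N] then hobox (t z) (\row_i (t z 0%R i + e))%R else set0.
apply: (@le_trans _ _ (\sum_z nu (S z))%E).
  apply: outer_measure_fin_cover => x xab.
  have xj j : (Num.truncn ((x 0 j - a 0 j) / e)%R < m j)%N.
    rewrite ltnS truncn_ge_nat; last first.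
      by rewrite divr_ge0 ?(ltW e0)// subr_ge0 ab.
    have /andP[ax xb] := xab j.
    apply: (@le_trans _ _ ((x 0 j - a 0 j) / e)%R).
      by rewrite truncn_le divr_ge0 ?(ltW e0)// subr_ge0.
    by rewrite ler_pM2r ?invr_gt0// lerD2r ltW.
  exists [ffun j => Ordinal (leq_trans (xj j) (mM j))].
  rewrite /S ifT; last by apply/forallP => j; rewrite ffunE; exact: xj.
  move=> j; rewrite !mxE ffunE /=; have /andP[ax xb] := xab j.
  have q0 : (0 <= (x 0%R j - a 0%R j) / e)%R by rewrite divr_ge0 ?(ltW e0)// subr_ge0.
  have /andP[] := truncn_itv q0; rewrite -natr1 ler_pdivlMr// ltr_pdivrMr//.
  by lra.
have nuS z : nu (S z) = ((\prod_j (z j < m j)%N%:R) * (e ^+ d.+1 * kappa))%:E.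
  rewrite /S; case: ifPn => [/forallP zm|].
    by rewrite nu_cube// big1 ?mul1r// => j _; rewrite zm.
  rewrite negb_forall => /existsP[j /negPf zj].
  by rewrite chart_measure0 (bigD1 j)//= zj !mul0r.
rewrite (eq_bigr _ (fun z _ => nuS z)).
rewrite sumEFin lee_fin -mulr_suml mulrA mulrC ler_wpM2l//.
rewrite -(bigA_distr_bigA (fun j (k : 'I_M) => (k < m j)%N%:R : R)).
have -> : e ^+ d.+1 = \prod_(j < d.+1) e by rewrite prodr_const card_ord.
rewrite -big_split/=; apply: ler_prod => j _.
rewrite mulr_ge0 ?sumr_ge0 ?(ltW e0)//= -natr_sum.
rewrite (_ : (\sum_(k < M) (k < m j))%N = m j); last first.
  rewrite -(big_mkord xpredT (fun k => (k < m j)%N : nat)) (@big_cat_nat _ _ _ (m j) 0 M _ _ (leq0n _) (mM j))/=.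
  rewrite (eq_big_nat _ _ (F2 := fun=> 1%N)); last by move=> k /andP[_ ->].
  rewrite sum_nat_const_nat subn0 muln1 big_nat_cond big1 ?addn0// => k.
  by rewrite andbT => /andP[mk _]; rewrite ltnNge mk.
rewrite -natr1 mulrDl mul1r lerD2r -ler_pdivlMr// truncn_le divr_ge0 ?(ltW e0)//.
by rewrite subr_ge0.
Qed.

Lemma chart_measure_hobox (a b : 'rV[R]_d.+1) : (forall i, a 0 i <= b 0 i) ->
  (nu (hobox a b) <= (kappa * vol a b)%:E)%E.
Proof.
move=> ab; apply/lee_addgt0Pr => e e0.
(* [kappa] may still be 0 here, hence the added 1 in the denominator. *)
have k1 : 0 < kappa + 1 by rewrite ltr_wpDl.
have [t t0 tP] := @prod_shift_small _ _ (fun j => b 0 j - a 0 j) _ (divr_gt0 e0 k1).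
apply: le_trans (chart_measure_hobox_eps t0 ab) _.
rewrite -EFinD lee_fin; apply: (le_trans (ler_wpM2l kappa0 tP)).
rewrite mulrDr lerD2l mulrCA ger_pMr// ler_pdivrMr// mul1r; lra.
Qed.

Hypothesis nu_gt0 : (0 < nu (@unit_box d.+1))%E.

Let kappa_gt0 : 0 < kappa.
Proof. by rewrite -lte_fin -kappaE. Qed.

(** The bound on single boxes, summed over a cover by boxes; on the side of [nu] only subadditivity
    enters. *)
Lemma chart_measure_le (A : set 'rV[R]_d.+1) : (nu A <= kappa%:E * lebesgue_rV A)%E.
Proof.
rewrite -lee_pdivrMl//; apply: le_ereal_inf_tmp => _ [a [b [ab Aab ->]]].
rewrite lee_pdivrMl// -nneseriesZl; last first.
  by move=> k _; rewrite lee_fin; apply: vol_ge0 => i; exact: ab.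
apply: (@le_trans _ _ (\sum_(0 <= k <oo) nu (hobox (a k) (b k)))%E).
  apply: le_trans (outer_measure_sigma_subadditive nu (fun k => hobox (a k) (b k))).
  exact: le_outer_measure.
apply: lee_nneseries => [k _ _|k _]; first exact: outer_measure_ge0.
by rewrite -EFinM; apply: chart_measure_hobox => i; exact: ab.
Qed.

(* Both [nu A] and [nu (C `\` A)] are at most [kappa] times the Lebesgue measure, and
   these bounds add up to an equality on the cube [C]. *)
Lemma chart_measureE (A : set (borel_rV R d.+1)) (t : 'rV[R]_d.+1) (L : R) :
  0 < L -> measurable A -> A `<=` hobox t (\row_i (t 0 i + L)) ->
  nu A = (kappa%:E * lebesgue_rV A)%E.
Proof.
move=> L0 mA; set C := hobox t _ => AC.
have tL i : t 0 i <= (\row_i (t 0 i + L)) 0 i :> R by rewrite mxE lerDl ltW.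
have volC : vol t (\row_i (t 0 i + L)) = L ^+ d.+1.
  rewrite /vol (eq_bigr (fun=> L)) ?prodr_const ?card_ord// => i _.
  by rewrite mxE addrC addKr.
have CL : (lebesgue_rV C <= (L ^+ d.+1)%:E)%E by rewrite -volC lebesgue_hobox_le.
have nuC : nu C = (kappa%:E * (L ^+ d.+1)%:E)%E by rewrite nu_cube// mulrC EFinM.
have CE : (lebesgue_rV A + lebesgue_rV (C `&` ~` A) = lebesgue_rV C)%E.
  by rewrite [RHS](borel_caratheodory mA C) (setIidr AC).
have fin D : D `<=` C -> lebesgue_rV D \is a fin_num.
  move=> DC; rewrite ge0_fin_numE ?lebesgue_rV_ge0//.
  by rewrite (le_lt_trans (le_lebesgue_rV DC))// (le_lt_trans CL)// ltry.
have fA := fin _ AC; have fA' := fin (C `&` ~` A) (@subIsetl _ _ _).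
have nuCle : (nu C <= nu A + nu (C `&` ~` A))%E.
  by rewrite -{1}(setIidr AC); exact: le_outer_measureIC.
have H1 := chart_measure_le A; have H2 := chart_measure_le (C `&` ~` A).
apply/eqP; rewrite eq_le H1/=; move: nuCle H1 H2 CE CL; rewrite nuC.
rewrite -(fineK fA) -(fineK fA').
have [u ->] : exists u, nu A = u%:E.
  exists (fine (nu A)); rewrite fineK// ge0_fin_numE ?outer_measure_ge0//.
  by rewrite (le_lt_trans (chart_measure_le A))// -(fineK fA) -EFinM ltry.
have [v ->] : exists v, nu (C `&` ~` A) = v%:E.
  exists (fine (nu (C `&` ~` A))); rewrite fineK// ge0_fin_numE ?outer_measure_ge0//.
  by rewrite (le_lt_trans (chart_measure_le _))// -(fineK fA') -EFinM ltry.
move: (fine (lebesgue_rV A)) (fine (lebesgue_rV (C `&` ~` A))) => x y; rewrite -!EFinM -!EFinD !lee_fin.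
move=> h h1 h2 <-; rewrite lee_fin => h3.
have : kappa * (x + y) <= kappa * L ^+ d.+1 by rewrite (ler_pM2l kappa_gt0).
by rewrite mulrDr; lra.
Qed.

End Comparison.

Lemma mulmx_coord_le n d (x y : 'rV[R]_n) (M : 'M[R]_(n, d)) i :
  (`|((x - y) *m M) 0 i| <= (\sum_k \sum_j `|M k j|) * edist x y)%R.
Proof.
rewrite mxE (le_trans (ler_norm_sum _ _ _))// mulr_suml; apply: ler_sum => k _.
rewrite normrM mulrC; apply: ler_pM => //.
  by rewrite (bigD1 i)//= lerDl sumr_ge0.
rewrite -sqrtr_sqr ler_wsqrtr// expr2 /dotv (bigD1 k)//= lerDl.
by apply: sumr_ge0 => j _; rewrite -expr2 sqr_ge0.
Qed.

Lemma exprD_le2 (x y : R) n : (0 <= x -> 0 <= y ->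
  (x + y) ^+ n <= 2 ^+ n * (x ^+ n + y ^+ n))%R.
Proof.
move=> x0 y0; wlog xy : x y x0 y0 / (x <= y)%R.
  move=> H; have [xy|/ltW yx] := leP x y; first exact: H.
  by rewrite addrC (addrC (x ^+ n)%R); exact: H.
apply: (@le_trans _ _ ((2 * y) ^+ n)%R).
  by rewrite lerXn2r ?nnegrE ?addr_ge0 ?mulr_ge0//; lra.
by rewrite exprMn ler_wpM2l ?exprn_ge0// lerDr exprn_ge0.
Qed.

(** The chart is Lipschitz, so it maps a set of diameter [D] into a box of side [2 * L * D]; a cover
    for the Hausdorff measure thus yields a box cover at proportional cost. This serves to show that
    [kappa] is positive. *)
Lemma lebesgue_le_chart_measure n d p0 (B : 'M[R]_(d.+1, n)) : row_free B ->
  exists2 K : R, (0 < K)%R & forall A, lebesgue_rV A <= K%:E * chart_measure p0 B A.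
Proof.
move=> fB; pose L := (\sum_k \sum_j `|(pinvmx B) k j| + 1)%R.
have L0 : (0 < L)%R.
  by rewrite ltr_wpDl//; apply: sumr_ge0 => k _; apply: sumr_ge0.
have chL x y i : (`|(chart p0 B x) 0%R i - (chart p0 B y) 0%R i| <= L * edist x y)%R.
  have -> : ((chart p0 B x) 0 i - (chart p0 B y) 0 i = ((x - y) *m pinvmx B) 0 i)%R.
    rewrite (_ : x - y = (x - p0) - (y - p0))%R; last by rewrite opprB addrA subrK.
    by rewrite mulmxBl [RHS]mxE [X in (_ = _ + X)%R]mxE.
  apply: (le_trans (mulmx_coord_le _ _ _ _)); rewrite ler_wpM2r ?sqrtr_ge0//.
  by rewrite /L lerDl.
exists (2 ^+ d.+1 * (2 * L) ^+ d.+1)%R; first by rewrite mulr_gt0// exprn_gt0// mulr_gt0.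
(* Covers at the single scale 1 suffice, and this scale forces their diameters to be finite. *)
move=> A; apply: (@le_trans _ _ ((2 ^+ d.+1 * (2 * L) ^+ d.+1)%:E *
    hausdorff_pre d.+1 1 (emb p0 B @` A))); last first.
  by rewrite lee_wpmul2l ?hausdorff_pre_le// lee_fin mulr_ge0 ?exprn_ge0// mulr_ge0// ltW.
have K0 : (0 < 2 ^+ d.+1 * (2 * L) ^+ d.+1)%R.
  by rewrite mulr_gt0// exprn_gt0// mulr_gt0.
rewrite -lee_pdivrMl//; apply: le_ereal_inf_tmp => _ [C [AC dC ->]].
rewrite lee_pdivrMl//; apply/lee_addgt0Pr => e e0.
have C0 k : ediam (C k) = (fine (ediam (C k)))%:E.
  by rewrite fineK// ge0_fin_numE ?ediam_ge0// (le_lt_trans (dC k))// ltry.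
pose D k : R := fine (ediam (C k)).
have D0 k : (0 <= D k)%R by rewrite fine_ge0// ediam_ge0.
(* Chosen so that [g k <= 1], whence [g k ^+ d.+1 <= g k], and so that the corrections
   [2 ^+ d.+1 * g k] add up to at most [e]. *)
pose f : R := (e / (2 ^+ d.+1 * (1 + e)))%R.
have f0 : (0 < f)%R by rewrite divr_gt0// mulr_gt0// ?exprn_gt0// addr_gt0.
pose g k : R := (f / (2 ^ k.+1)%:R)%R.
have g0 k : (0 < g k)%R by rewrite divr_gt0// ltr0n expn_gt0.
have g1 k : (g k <= 1)%R.
  rewrite /g /f -mulrA -invfM ler_pdivrMr ?mulr_gt0// ?exprn_gt0// ?ltr0n ?expn_gt0// ?addr_gt0//.
  rewrite mul1r -mulrA -natrX -[X in (X <= _)%R]mul1r.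
  have h1 : (1 <= (2 ^ d.+1)%:R :> R)%R by rewrite ler1n expn_gt0.
  have h2 : (1 <= (2 ^ k.+1)%:R :> R)%R by rewrite ler1n expn_gt0.
  apply: ler_pM => //; first exact: ltW.
  rewrite -[X in (X <= _)%R]mulr1; apply: ler_pM => //; first exact: ltW.
  by rewrite lerDr.
(* A point of [C k] is within [L * D k] of any other in each coordinate; [g k] makes the
   half-open box nondegenerate. *)
have [c cE] : exists c : nat -> 'rV[R]_d.+1, forall k, c k = chart p0 B (xget 0%R (C k)).
  by exists (fun k => chart p0 B (xget 0%R (C k))).
pose a k : 'rV[R]_d.+1 := (\row_i (c k 0 i - L * D k - g k / 2))%R.
pose b k : 'rV[R]_d.+1 := (\row_i (c k 0 i + L * D k + g k / 2))%R.
have vE k : vol (a k) (b k) = ((2 * L * D k + g k) ^+ d.+1)%R.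
  rewrite /vol (eq_bigr (fun=> 2 * L * D k + g k)%R) ?prodr_const ?card_ord// => i _.
  by rewrite !mxE; lra.
have ab k i : (a k 0%R i <= b k 0%R i)%R.
  rewrite !mxE; have := mulr_ge0 (ltW L0) (D0 k); have := g0 k; lra.
apply: (@le_trans _ _ (\sum_(0 <= k <oo) (vol (a k) (b k))%:E)).
  apply: ereal_inf_lbound; exists a, b; split => // x Ax.
  have [k _ Ck] : (\bigcup_k C k) (emb p0 B x) by apply: AC; exists x.
  exists k => // i; rewrite !mxE.
  have Cx : C k (xget 0%R (C k)) by apply: xgetPex; exists (emb p0 B x).
  have := chL (emb p0 B x) (xget 0%R (C k)) i; rewrite embK// -cE => h.
  have : (edist (emb p0 B x) (xget 0 (C k)) <= D k)%R.
    by rewrite -lee_fin -C0 edist_ediam.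
  move=> /(ler_wpM2l (ltW L0)); have := g0 k; move: h; rewrite ler_norml; lra.
apply: (@le_trans _ _ (\sum_(0 <= k <oo) ((2 ^+ d.+1 * (2 * L) ^+ d.+1)%:E *
    ediam (C k) ^+ d.+1 + (2 ^+ d.+1 * f / (2 ^ k.+1)%:R)%:E))).
  apply: lee_nneseries => [k _ _|k _]; first by rewrite lee_fin vol_ge0.
  rewrite vE C0 -EFin_expe -EFinM -EFinD lee_fin.
  have LD0 : (0 <= 2 * L * D k)%R by rewrite !mulr_ge0// ltW.
  apply: (le_trans (exprD_le2 _ LD0 (ltW (g0 k)))).
  rewrite exprMn mulrDr mulrA lerD2l -[X in (_ <= X)%R]mulrA ler_wpM2l ?exprn_ge0//.
  by rewrite exprS ger_pMr// exprn_ile1// ltW.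
apply: le_trans (epsilon_trick _ _ _) _ => //.
- by move=> k; rewrite mule_ge0 ?expe_ge0 ?ediam_ge0// lee_fin ltW.
- by rewrite mulr_ge0 ?exprn_ge0// ltW.
rewrite nneseriesZl; last by move=> k _; rewrite expe_ge0 ?ediam_ge0.
rewrite leeD2l// lee_fin /f invfM mulrCA mulVKf ?expf_neq0//.
rewrite ler_pdivrMr ?addr_gt0// ler_peMr ?(ltW e0)// lerDl; exact: ltW.
Qed.

End ChartMeasure.

(** * Hausdorff measure on a facet *)

Section FacetMeasure.
Context {R : realType}.

Lemma polytope_bounded n (Q : set 'rV[R]_n) : is_polytope Q ->
  exists t L, 0 < L /\ Q `<=` hobox t (\row_i (t 0 i + L)).
Proof.
move=> /polytopeP[k [q ->]].
pose M := \sum_i \sum_j `|q i 0 j|.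
have M0 : 0 <= M by apply: sumr_ge0 => i _; apply: sumr_ge0.
exists (const_mx (- (M + 1))), (2 * (M + 1)); split; first by rewrite mulr_gt0// ltr_wpDl.
move=> x; rewrite conv_hull_rangeE => -[w [w0 w1 ->]] j; rewrite !mxE summxE.
have : `|\sum_i (w i *: q i) 0 j| <= M.
  apply: (le_trans (ler_norm_sum _ _ _)); apply: ler_sum => i _.
  rewrite mxE normrM (ger0_norm (w0 i)).
  have wi1 : w i <= 1 by rewrite -w1 (bigD1 i)//= lerDl sumr_ge0.
  apply: (@le_trans _ _ `|q i 0 j|); first by rewrite ler_piMl.
  by rewrite (bigD1 j)//= lerDl sumr_ge0.
by rewrite ler_norml; lra.
Qed.

Lemma closed_borel n (A : set 'rV[R]_n) : closed A -> measurable (A : set (borel_rV R n)).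
Proof.
move=> cA; rewrite -[A]setCK; apply: (@measurableC _ (borel_rV R n)).
by apply: sub_sigma_algebra; rewrite /= openC.
Qed.

(** The cube of side [1 / (d + 1)] lies in the coordinate simplex, hence in [Q]. Enlarged [d + 1]
    times, [Q] covers the unit box, which makes [kappa] finite; the comparison with Lebesgue measure
    makes it positive. *)
Lemma facet_measure n d (F : set 'rV[R]_n) (p0 : 'rV[R]_n) (B : 'M[R]_(d.+1, n)) :
  is_polytope F -> row_free B -> F p0 -> (forall x, F x -> (x - p0 <= B)%MS) ->
  (forall i, F (p0 + row i B)) -> (hausdorff d.+1 F < +oo)%E ->
  let Q := chart p0 B @` F in exists kappa : R,
  [/\ 0 < kappa, (0 < lebesgue_rV Q < +oo)%E &
    forall A : set (borel_rV R d.+1), measurable A ->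
    hausdorff d.+1 (F `&` chart p0 B @^-1` A) = (kappa%:E * lebesgue_rV (A `&` Q))%E].
Proof.
move=> Fp fB Fp0 FB Frow Hfin Q.
have FQ : emb p0 B @` Q = F.
  rewrite image_comp; apply/seteqP; split=> x.
    by move=> [y Fy <-] /=; rewrite chartK//; exact: FB.
  by move=> Fx; exists x => //=; rewrite chartK//; exact: FB.
have Qp : is_polytope Q.
  have [k [q FE]] := polytopeP Fp.
  by rewrite /Q FE chart_conv_hull; exact: is_polytope_range.
have nuQ : chart_measure p0 B Q = hausdorff d.+1 F by rewrite /chart_measure FQ.
pose r : R := d.+1%:R^-1.
have r0 : 0 < r by rewrite invr_gt0.
have cubeQ : [set x : 'rV[R]_d.+1 | forall j, 0 <= x 0 j <= r] `<=` Q.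
  move=> y yr; exists (emb p0 B y); last exact: embK.
  apply: frame_simplex => // [i|]; first by have /andP[] := yr i.
  apply: (@le_trans _ _ (\sum_(i < d.+1) r)).
    by apply: ler_sum => i _; have /andP[] := yr i.
  by rewrite sumr_const card_ord -[r *+ _]mulr_natl /r divff.
have ufin : (chart_measure p0 B (@unit_box R d.+1) < +oo)%E.
  apply: (@le_lt_trans _ _ ((r^-1 ^+ d.+1)%:E * chart_measure p0 B Q)%E); last first.
    rewrite nuQ lte_mul_pinfty ?lee_fin ?exprn_ge0 ?invr_ge0 ?(ltW r0)//.
  rewrite -(chart_measure_homothety p0 B 0 Q) ?invr_gt0//.
  apply: le_chart_measure => x xu; exists (r *: x).
    apply: cubeQ => j; have := xu j; rewrite !mxE => /andP[x0 x1].
    by rewrite mulr_ge0 ?(ltW r0)//= ger_pMr// ltW.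
  by rewrite scalerA mulVf ?gt_eqF// scale1r addr0.
have upos : (0 < chart_measure p0 B (@unit_box R d.+1))%E.
  have [K K0 HK] := lebesgue_le_chart_measure p0 fB.
  (* The closed cube of side 1/2 fits into the half-open unit box. *)
  have h0 : 0 < 2^-1 :> R by rewrite invr_gt0.
  have H : ((2^-1 ^+ d.+1)%:E <= lebesgue_rV (@unit_box R d.+1))%E.
    apply: le_trans (lebesgue_cube_ge _ h0) _; apply: le_lebesgue_rV => x xh j.
    by rewrite !mxE; have := xh j; lra.
  rewrite lt_neqAle eq_sym chart_measure_ge0 andbT; apply/eqP => u0.
  have := le_trans H (HK _); rewrite u0 mule0 leNgt.
  by rewrite lte_fin exprn_gt0.
exists (fine (chart_measure p0 B (@unit_box R d.+1))); split.
- by rewrite fine_gt0// upos.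
- have [t [L [L0 QL]]] := polytope_bounded Qp.
  apply/andP; split.
    apply: lt_le_trans (le_lebesgue_rV cubeQ).
    by apply: lt_le_trans (lebesgue_cube_ge _ r0); rewrite lte_fin exprn_gt0.
  apply: le_lt_trans (le_lebesgue_rV QL) _.
  apply: le_lt_trans (lebesgue_hobox_le _) (ltry _).
  by move=> i; rewrite mxE lerDl ltW.
- move=> A mA.
  have -> : F `&` chart p0 B @^-1` A = emb p0 B @` (A `&` Q).
    apply/seteqP; split=> x.
      move=> [Fx Ax]; exists (chart p0 B x); last by rewrite chartK//; exact: FB.
      by split=> //; exists x.
    move=> [y [Ay [z Fz zy]] <-]; rewrite -zy chartK; last exact: FB.
    by split=> //=; rewrite zy.
  rewrite -/(chart_measure p0 B (A `&` Q)).
  have [t [L [L0 QL]]] := polytope_bounded Qp.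
  apply: (@chart_measureE _ _ _ _ _ ufin upos (A `&` Q) t L L0).
    apply: (@measurableI _ (borel_rV R d.+1)) => //; apply: closed_borel.
    exact: polytope_closed.
  by move=> x [_ /QL].
Qed.

End FacetMeasure.

(** * Conditional samples *)

Section ConditionalSample.
Context {R : realType}.

(** For an event of mass 0, [mnormalize] falls back to [Pr]; the laws below are stated for positive
    mass. *)
Definition cond_prob d (T : measurableType d) (Pr : probability T R) (E : set T)
    (mE : measurable E) : probability T R := mnormalize (mrestr Pr mE) Pr.

Lemma cond_probE d (T : measurableType d) (Pr : probability T R) (E : set T)
    (mE : measurable E) (U : set T) :
  (0 < Pr E)%E -> cond_prob Pr mE U = (Pr (U `&` E) * (fine (Pr E))^-1%:E)%E.
Proof.
move=> E0; rewrite /cond_prob /= /mnormalize /= /mrestr setTI ifF//.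
apply/negbTE; rewrite negb_or gt_eqF//= -ltey.
by rewrite -ge0_fin_numE// fin_num_measure.
Qed.

Definition RV_of d (T : measurableType d) (Pr : probability T R)
    d' (T' : measurableType d') (f : T -> T') (mf : measurable_fun setT f) :
    {RV Pr >-> T'} := mfun_Sub (mem_set mf).

Variables (d : measure_display) (T : measurableType d) (Pr : probability T R).
Variables (n m N k : nat) (X : 'I_N -> {RV Pr >-> borel_rV R n}).
Hypothesis indep : mutually_independent X.
Variables (F : set (borel_rV R n)) (mF : measurable F) (p : R).
Hypothesis XF : forall i, Pr (X i @^-1` F) = p%:E.
Variables (g : borel_rV R n -> borel_rV R m) (mg : measurable_fun setT g).
Variable q : set (borel_rV R m) -> R.
Hypothesis Xq : forall i A, measurable A ->
  Pr (X i @^-1` (F `&` g @^-1` A)) = (p * q A)%:E.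
Variables (e : 'I_k -> 'I_N) (e_inj : injective e).

(** The conditioning is on which points fall in [F], not only on how many: this gives a product
    event, one condition per sample point, to which independence applies directly. *)
Definition hit_event : set T :=
  [set w | forall i, F (X i w) <-> exists j, e j = i].

Let C (A : 'I_k -> set (borel_rV R m)) (i : 'I_N) : set (borel_rV R n) :=
  if [pick j | e j == i] is Some j then F `&` g @^-1` (A j) else ~` F.

Let mC A i : (forall j, measurable (A j)) -> measurable (C A i).
Proof.
move=> mA; rewrite /C; case: pickP => [j _|_]; last exact: measurableC.
by apply: measurableI => //; rewrite -[_ @^-1` _]setTI; exact: mg.
Qed.

Let hitC A : hit_event `&` [set w | forall j, A j (g (X (e j) w))] =
  [set w | forall i, C A i (X i w)].
Proof.
apply/seteqP; split=> w.
  move=> [hw Aw] i; rewrite /C; case: pickP => [j /eqP ji|no].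
    by split; [apply/hw; exists j|rewrite -ji; exact: Aw].
  by move=> /hw[j ji]; have := no j; rewrite ji eqxx.
move=> Cw; split=> [i|j].
  have := Cw i; rewrite /C; case: pickP => [j /eqP ji [Fi _]|no nFi].
    by split=> // _; exists j.
  by split=> // -[j ji]; have := no j; rewrite ji eqxx.
have := Cw (e j); rewrite /C; case: pickP => [j' /eqP /e_inj -> []//|/(_ j)].
by rewrite eqxx.
Qed.

Let mCw A : (forall j, measurable (A j)) -> measurable [set w | forall i, C A i (X i w)].
Proof.
move=> mA; rewrite (_ : mkset _ = \bigcap_(i in [set: 'I_N]) X i @^-1` C A i).
  apply: fin_bigcap_measurable; first exact: finite_finset.
  by move=> i _; rewrite -[_ @^-1` _]setTI; apply: measurable_funPT => //; exact: mC.
by apply/seteqP; split=> w H i; [move=> _|]; exact: H.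
Qed.

Lemma measurable_hit_event : measurable hit_event.
Proof.
have := hitC (fun=> setT); rewrite (_ : [set w | _] = setT) ?setIT.
  by move=> ->; apply: mCw => j; exact: measurableT.
by apply/seteqP; split.
Qed.

(** The total mass of [q] is read off from [Xq] at the full set, which takes an index and a division
    by [p]. *)
Let qT : (0 < k)%N -> p != 0 -> q setT = 1.
Proof.
move=> k0 p0; have i : 'I_N by exact: e (Ordinal k0).
have := Xq i (@measurableT _ _); rewrite preimage_setT setIT XF => -[/esym pq].
by apply: (mulfI p0); rewrite pq mulr1.
Qed.

(** Independence gives one factor per index: [p * q (A j)] at [e j], and [1 - p] at the indices
    outside the image of [e]. *)
Lemma hit_event_prob A : (forall j, measurable (A j)) ->
  Pr (hit_event `&` [set w | forall j, A j (g (X (e j) w))]) =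
  (p ^+ k * (1 - p) ^+ (N - k) * \prod_j q (A j))%:E.
Proof.
move=> mA; rewrite hitC indep; last by move=> i; exact: mC.
pose c i := if [pick j | e j == i] is Some j then p else 1 - p.
pose r i := if [pick j | e j == i] is Some j then q (A j) else 1.
have XC i : Pr (X i @^-1` C A i) = (c i * r i)%:E.
  rewrite /C /c /r; case: pickP => [j _|_]; first exact: Xq.
  by rewrite mulr1 preimage_setC probability_setC ?XF//; apply: measurable_funPTI.
rewrite (eq_bigr _ (fun i _ => XC i)) prodEFin big_split/=; congr (_ * _)%:E.
  rewrite (bigID (fun i => isSome [pick j | e j == i]))/=.
  rewrite (eq_bigr (fun=> p)); last by move=> i; rewrite /c; case: pickP.
  rewrite [X in _ * X](eq_bigr (fun=> 1 - p)); last first.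
    by move=> i; rewrite /c; case: pickP.
  have ck : #|[pred i | isSome [pick j | e j == i]]| = k.
    rewrite -[RHS]card_ord -(card_codom e_inj); apply: eq_card => i.
    rewrite !inE; case: pickP => [j /eqP <-|no]; first by rewrite codom_f.
    by apply/esym/negbTE/codomP => -[j ji]; have := no j; rewrite ji eqxx.
  rewrite !prodr_const ck; congr (_ ^+ _ * _ ^+ _).
  have := cardC [pred i | isSome [pick j | e j == i]]; rewrite ck card_ord => cN.
  rewrite (_ : (N - k)%N = #|[predC [pred i | isSome [pick j | e j == i]]]|).
    by apply: eq_card => i; rewrite !inE.
  by apply/eqP; rewrite -(eqn_add2l k) cN subnKC // -cN leq_addr.
rewrite (bigID (fun i => isSome [pick j | e j == i]))/= [X in _ * X]big1 ?mulr1; last first.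
  by move=> i; rewrite /r; case: pickP.
have pe j : [pick j' | e j' == e j] = Some j.
  case: pickP => [j' /eqP/e_inj ->//|/(_ j)]; by rewrite eqxx.
rewrite (reindex_omap e (fun i => [pick j | e j == i])); last first.
  by move=> i; case: pickP => [j /eqP <-|].
by apply: eq_big => j; rewrite /r pe ?eqxx.
Qed.

Lemma hit_event_prob0 : Pr hit_event = (p ^+ k * (1 - p) ^+ (N - k))%:E.
Proof.
have := hit_event_prob (fun=> @measurableT _ _).
rewrite (_ : [set w | _] = setT) ?setIT; last by apply/seteqP; split.
move=> ->; have [k0|k0] := posnP k; first by rewrite k0 big_ord0 mulr1.
(* For [p = 0] the values of [q] are unconstrained, but [p ^+ k] makes both sides vanish. *)
have [->|p0] := eqVneq p 0; first by rewrite expr0n/= -[k]prednK//= !mul0r.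
by rewrite big1 ?mulr1// => j _; exact: qT.
Qed.

Hypothesis E0 : (0 < Pr hit_event)%E.

Let mY j : measurable_fun setT (g \o X (e j)).
Proof. by apply: measurableT_comp. Qed.

Let mE := measurable_hit_event.

Definition cond_RV (j : 'I_k) : {RV (cond_prob Pr mE) >-> borel_rV R m} :=
  RV_of (cond_prob Pr mE) (mY j).

Let cond_joint A : (forall j, measurable (A j)) ->
  cond_prob Pr mE [set w | forall j, A j (g (X (e j) w))] = (\prod_j q (A j))%:E.
Proof.
move=> mA; rewrite cond_probE// setIC hit_event_prob// -EFinM; congr EFin.
have := E0; rewrite hit_event_prob0/= lte_fin => pk.
by rewrite mulrAC divff ?mul1r// gt_eqF.
Qed.

Let cond_marginal j (B : set (borel_rV R m)) : measurable B ->
  cond_prob Pr mE (cond_RV j @^-1` B) = (q B)%:E.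
Proof.
move=> mB; have k0 : (0 < k)%N by exact: leq_ltn_trans (ltn_ord j).
have p0 : p != 0.
  apply: contraTneq E0 => p0; rewrite hit_event_prob0 p0 expr0n -[k]prednK//=.
  by rewrite mul0r ltxx.
have := @cond_joint (fun j' => if j' == j then B else setT).
rewrite (bigD1 j)//= eqxx big1 ?mulr1 => [<-|j' /negPf ->]; last exact: qT.
  congr (cond_prob _ _ _); apply/seteqP; split=> w /=.
    by move=> Bw j'; case: eqP => [->|].
  by move=> /(_ j); rewrite eqxx.
by move=> j'; case: eqP.
Qed.

Lemma cond_RV_distribution j (B : set (borel_rV R m)) : measurable B ->
  distribution (cond_prob Pr mE) (cond_RV j) B = (q B)%:E.
Proof. exact: cond_marginal. Qed.

Lemma cond_RV_independent : mutually_independent cond_RV.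
Proof.
move=> A mA; rewrite (eq_bigr _ (fun j _ => cond_marginal j (mA j))) prodEFin.
exact: cond_joint.
Qed.

End ConditionalSample.

(** * Lower integrals and conditioning *)

Section LowerIntegral.
Context {R : realType}.
Local Open Scope ereal_scope.
Import HBNNSimple.

(** On subsets of [E] the conditional law is [Pr] divided by the mass of [E]; on subsets of the
    complement it is 0. *)
Lemma integral_cond_prob d (T : measurableType d) (Pr : probability T R) (E : set T)
    (mE : measurable E) (h : {nnsfun T >-> R}) : 0 < Pr E ->
  \int[cond_prob Pr mE]_x (h x)%:E = (fine (Pr E))^-1%:E * \int[Pr]_(x in E) (h x)%:E.
Proof.
move=> E0.
have k0 : (0 <= (fine (Pr E))^-1)%R by rewrite invr_ge0 fine_ge0.
have mh (D : set T) : measurable_fun D (EFin \o h).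
  by apply/measurable_EFinP; apply: measurable_funTS.
rewrite -[in LHS](setUv E) (ge0_integral_setU _ mE (measurableC mE))/=; last 3 first.
- by rewrite setUv; exact: mh.
- by move=> x _; rewrite lee_fin.
- by apply/disj_setPS => x [].
rewrite (@eq_measure_integral _ _ _ _ (mscale (NngNum k0) Pr)); last first.
  by move=> A mA AE; rewrite /= cond_probE// /mscale /= (setIidl AE) muleC.
rewrite ge0_integral_mscale//=; last by move=> x _; rewrite lee_fin.
rewrite [X in _ + X](@eq_measure_integral _ _ _ _ mzero) ?integral_measure_zero ?adde0//.
move=> A mA AE; rewrite /= cond_probE// /mzero (_ : A `&` E = set0) ?measure0 ?mul0e//.
by apply/seteqP; split=> // x [/AE].
Qed.

(** The expectation is a supremum of integrals of simple functions, so the strict inequality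
    supplies a simple [h] below [f]. Such witnesses, unlike [f], can be cut off to their events and
    summed. *)
Lemma lower_expectation_cond d (T : measurableType d) (Pr : probability T R) (E : set T)
    (mE : measurable E) (f : T -> R) (L : R) :
  0 < Pr E -> (forall x, 0 <= f x)%R -> L%:E < 'E_(cond_prob Pr mE)[f] ->
  exists2 h : {nnsfun T >-> R}, (forall x, h x <= f x)%R &
    (L * fine (Pr E))%:E <= \int[Pr]_(x in E) (h x)%:E.
Proof.
move=> E0 f0; rewrite unlock ge0_integralTE => [|x]; last by rewrite lee_fin.
move=> /ereal_sup_gt[_ [h hf <-]] Lh; exists h.
  by move=> x; rewrite -lee_fin.
move: Lh; rewrite -integralT_nnsfun integral_cond_prob// => Lh.
have Pf : (0 < fine (Pr E))%R by rewrite fine_gt0// E0 ltey_eq fin_num_measure.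
have := ltW Lh; rewrite muleC lee_pdivlMr// -EFinM.
Qed.

(** Every simple function below [g] is below [f], hence competes in the supremum for [f]. *)
Lemma le_lower_expectation d (T : measurableType d) (Pr : probability T R)
    (f : T -> R) (g : T -> \bar R) : (forall x, 0 <= f x)%R ->
  (forall x, 0 <= g x) -> measurable_fun setT g -> (forall x, g x <= (f x)%:E) ->
  \int[Pr]_x g x <= 'E_Pr[f].
Proof.
move=> f0 g0 mg gf; rewrite unlock !ge0_integralTE//.
apply: ereal_sup_le => _ [h hg <-]; exists h => // x.
exact: le_trans (hg x) (gf x).
Qed.

End LowerIntegral.

(** * Sample points and facets *)

Section FacetLaw.
Context {R : realType}.

Lemma continuous_borel n m (f : 'rV[R]_n -> 'rV[R]_m) : continuous f ->
  measurable_fun setT (f : borel_rV R n -> borel_rV R m).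
Proof.
move=> cf; apply: (@measurability _ _ (borel_rV R n) (borel_rV R m) setT f (@open 'rV[R]_m)) => //.
move=> _ [U oU <-]; rewrite setTI; apply: sub_sigma_algebra.
by move/continuousP : cf; apply.
Qed.

Lemma chart_continuous n d (p0 : 'rV[R]_n) (B : 'M[R]_(d, n)) :
  continuous (chart p0 B).
Proof.
rewrite (_ : chart p0 B = fun x => x *m pinvmx B - p0 *m pinvmx B); last first.
  by apply/funext => x; rewrite /chart mulmxBl.
move=> x; exact: (cvgB (@mulmxr_continuous _ _ _ (pinvmx B) x) (cvg_cst _)).
Qed.

(** A law has total mass 1, whereas the quotient defining it would be 0 for a set of measure 0 or
    [+oo]: division by 0 and [fine] of [+oo] both return 0. *)
Lemma uniform_boundary_fin n s (S : set 'rV[R]_n) (dd : measure_display)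
    (T : measurableType dd) (Pr : probability T R) (X : {RV Pr >-> borel_rV R n}) :
  uniform_on (@hausdorff R n s) S X ->
  0 < fine (hausdorff s S) /\ (hausdorff s S < +oo)%E.
Proof.
move=> /(_ setT measurableT); rewrite setTI probability_setT => -[h1].
have h0 : fine (hausdorff s S) != 0.
  by apply/eqP => h0; move: h1; rewrite h0 mul0r => /eqP; rewrite oner_eq0.
split; first by rewrite lt_neqAle eq_sym h0 fine_ge0// hausdorff_ge0.
by move: h0; have := hausdorff_ge0 s S; case: (hausdorff s S) => //= [r _ _|]; rewrite ?ltry// eqxx.
Qed.

Lemma facet_boundary n d (P F : set 'rV[R]_n) : has_dim P n -> is_face P F ->
  has_dim F d -> d != n -> F `<=` boundary P.
Proof.
move=> Pn [a [b [Pb ->]]] Fd dn x [Px /= xb].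
apply: (@nonzero_functional_boundary _ _ _ a b) => //.
by apply: (facet_functional_neq0 Pn Fd); rewrite eq_sym.
Qed.

(** [p] is the share of the boundary taken by [F]. The factor [kappa] cancels once [p] is divided
    out, so in the chart a point conditioned to lie in [F] is Lebesgue-uniform on [Q]. *)
Lemma facet_law d (P F : set 'rV[R]_d.+2) :
  is_polytope P -> has_dim P d.+2 -> is_face P F -> has_dim F d.+1 ->
  0 < fine (hausdorff d.+1 (boundary P)) -> (hausdorff d.+1 (boundary P) < +oo)%E ->
  exists p0 (B : 'M[R]_(d.+1, d.+2)), let Q := chart p0 B @` F in exists p : R,
  [/\ row_free B, forall x, F x -> (x - p0 <= B)%MS, is_polytope Q & has_dim Q d.+1] /\
  [/\ 0 < p,
    fine (hausdorff d.+1 (F `&` boundary P)) / fine (hausdorff d.+1 (boundary P)) = p &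
    forall A : set (borel_rV R d.+1), measurable A ->
    fine (hausdorff d.+1 ((F `&` chart p0 B @^-1` A) `&` boundary P)) /
      fine (hausdorff d.+1 (boundary P)) =
    p * (fine (lebesgue_rV (A `&` Q)) / fine (lebesgue_rV Q))].
Proof.
move=> hP Pn PF Fd h0 hoo; have Fp := face_polytope hP PF.
have [p0 [B [fB Fp0 FB Frow]]] := facet_frame Fp Fd.
have Fbd : F `<=` boundary P by apply: facet_boundary PF Fd _ => //; rewrite neq_ltn ltnSn.
have Hfin : (hausdorff d.+1 F < +oo)%E by exact: le_lt_trans (le_hausdorff _ Fbd) hoo.
have [kappa [k0 /andP[Q0 Qoo] HA]] := facet_measure Fp fB Fp0 FB Frow Hfin.
exists p0, B; set Q := chart p0 B @` F in HA Q0 Qoo *.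
have fQ : lebesgue_rV Q \is a fin_num by rewrite ge0_fin_numE ?lebesgue_rV_ge0.
have q0 : 0 < fine (lebesgue_rV Q) by rewrite fine_gt0// Q0.
have HF : hausdorff d.+1 F = (kappa%:E * lebesgue_rV Q)%E.
  by rewrite -[in LHS](setIT F) -(preimage_setT (chart p0 B)) HA// setTI.
exists (kappa * fine (lebesgue_rV Q) / fine (hausdorff d.+1 (boundary P))); split; split => //.
- have [k [q FE]] := polytopeP Fp.
  by rewrite /Q FE chart_conv_hull; exact: is_polytope_range.
- exact: chart_has_dim.
- by rewrite divr_gt0// mulr_gt0.
- by rewrite (setIidl Fbd) HF -{1}(fineK fQ).
- move=> A mA; rewrite setIAC (setIidl Fbd) HA//.
  have fA : lebesgue_rV (A `&` Q) \is a fin_num.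
    rewrite ge0_fin_numE ?lebesgue_rV_ge0//; apply: le_lt_trans Qoo.
    exact: le_lebesgue_rV.
  rewrite -{1}(fineK fA) /=; field.
  by rewrite !gt_eqF.
Qed.

(* Contractions of [F `&` G] towards a point of [F] outside [G] give infinitely many
   disjoint subsets of [F] of comparable measure. *)
Lemma facets_meet_null d (P F G : set 'rV[R]_d.+2) (dd : measure_display)
    (T : measurableType dd) (Pr : probability T R) (X : {RV Pr >-> borel_rV R d.+2}) :
  is_polytope P -> has_dim P d.+2 ->
  is_face P F -> has_dim F d.+1 -> is_face P G -> has_dim G d.+1 -> F <> G ->
  uniform_on (@hausdorff R d.+2 d.+1) (boundary P) X -> Pr (X @^-1` (F `&` G)) = 0%E.
Proof.
move=> hP Pn PF Fd PG Gd FG uX; have [h0 hoo] := uniform_boundary_fin uX.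
have Fp := face_polytope hP PF.
have Fbd : F `<=` boundary P by apply: facet_boundary PF Fd _ => //; rewrite neq_ltn ltnSn.
have [a [b [Pb GE]]] := PG.
have [x0 [Fx0 nGx0]] : exists x0, F x0 /\ ~ G x0.
  apply: contrapT => no; apply: FG; apply: (facet_sub_eq PF PG Fd Gd) => x Fx.
  by apply: contrapT => nGx; apply: no; exists x.
have x0b : dotv a x0 < b.
  have Px0 := face_sub PF Fx0.
  rewrite lt_neqAle Pb// andbT; apply/eqP => x0b; apply: nGx0.
  by rewrite GE.
(* Distinct ratios in [[1/2, 1)]: the contracted copies sit at different levels of [a], and each
   keeps at least the fraction [2^-(d+1)] of the measure. *)
pose lam (j : nat) : R := 1 - (j.+2%:R)^-1.
have lam2 j : 2^-1 <= lam j.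
  have : j.+2%:R^-1 <= 2^-1 :> R by rewrite lef_pV2 ?posrE// ler_nat.
  by rewrite /lam; move: (j.+2%:R^-1 : R) => u; lra.
have lam1 j : lam j < 1.
  have : 0 < j.+2%:R^-1 :> R by rewrite invr_gt0.
  by rewrite /lam; move: (j.+2%:R^-1 : R) => u; lra.
(* The slice of [F] at the level of the [j]-th copy contains this copy; slices are closed, hence
   Borel, and pairwise disjoint. *)
pose D j : set 'rV[R]_d.+2 := F `&` [set x | dotv a x = lam j * b + (1 - lam j) * dotv a x0].
have mD j : measurable (D j : set (borel_rV R d.+2)).
  by apply: closed_borel; apply: closedI; [exact: polytope_closed|exact: hyperplane_closed].
have tD : trivIset setT D.
  apply/trivIsetP => i j _ _ ij; apply/seteqP; split=> // x [[_ /= xi] [_ /= xj]].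
  have : (lam i - lam j) * (b - dotv a x0) = 0.
    by rewrite -(subrr (dotv a x)) {1}xi xj; move: (lam i) (lam j) => u v; ring.
  move=> /eqP; rewrite mulf_eq0 [X in _ || X]subr_eq0 [b == _]gt_eqF// orbF subr_eq0 => /eqP.
  rewrite /lam => /addrI /oppr_inj /invr_inj /eqP; rewrite eqr_nat => /eqP[ij'].
  by rewrite ij' eqxx in ij.
set pD := fine (hausdorff d.+1 ((F `&` G) `&` boundary P)) / fine (hausdorff d.+1 (boundary P)).
have finH A : A `<=` boundary P -> hausdorff d.+1 A \is a fin_num.
  move=> AP; rewrite ge0_fin_numE ?hausdorff_ge0//.
  exact: le_lt_trans (le_hausdorff _ AP) hoo.
have FGbd : F `&` G `<=` boundary P by move=> x [/Fbd].
have DP j : ((2^-1 ^+ d.+1 * pD)%:E <= distribution Pr X (D j))%E.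
  have Dbd : D j `<=` boundary P by move=> x [/Fbd].
  rewrite (uX _ (mD j)) lee_fin /pD mulrA ler_pM2r ?invr_gt0//.
  rewrite (setIidl FGbd) (setIidl Dbd) -lee_fin EFinM !fineK ?finH//.
  have l0 : 0 < lam j by apply: lt_le_trans (lam2 j); rewrite invr_gt0.
  apply: (@le_trans _ _ ((lam j ^+ d.+1)%:E * hausdorff d.+1 (F `&` G))%E).
    rewrite lee_wpmul2r ?hausdorff_ge0// lee_fin lerXn2r ?nnegrE ?invr_ge0//.
    exact: ltW.
  rewrite -(hausdorff_homothety _ _ ((1 - lam j) *: x0) l0).
  apply: le_hausdorff => _ [x [Fx Gx] <-]; split.
    have [k [q FE]] := polytopeP Fp; rewrite FE; apply: conv_hull_convex.
    - by rewrite (ltW l0) ltW.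
    - by rewrite -FE.
    - by rewrite -FE.
  rewrite /= dotvDr !dotvZr; congr (_ * _ + _).
  by move: Gx; rewrite GE => -[].
have sum_le M : M%:R * (2^-1 ^+ d.+1 * pD) <= 1.
  have mU : measurable (\big[setU/set0]_(i < M) D i : set (borel_rV R d.+2)).
    by apply: bigsetU_measurable => i _; exact: mD.
  have := probability_le1 (distribution Pr X) mU.
  rewrite measure_bigsetU//.
  move=> H; rewrite -lee_fin; apply: le_trans H.
  apply: (@le_trans _ _ (\sum_(i < M) (2^-1 ^+ d.+1 * pD)%:E)%E); last by apply: lee_sum => i _; exact: DP.
  by rewrite sumEFin sumr_const card_ord mulr_natl.
have pD0 : 0 <= pD by rewrite divr_ge0 ?fine_ge0 ?hausdorff_ge0// ltW.
have mFG : measurable (F `&` G : set (borel_rV R d.+2)).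
  apply: closed_borel; apply: closedI; apply: polytope_closed => //.
  exact: face_polytope hP PG.
rewrite -[LHS]/(distribution Pr X (F `&` G)) (uX _ mFG) -/pD; congr EFin.
apply/eqP; rewrite eq_le pD0 andbT leNgt; apply/negP => pDgt.
have e0 : 0 < 2^-1 ^+ d.+1 * pD by rewrite mulr_gt0// exprn_gt0// invr_gt0.
have := sum_le (Num.truncn (2^-1 ^+ d.+1 * pD)^-1).+1.
by rewrite -ler_pdivlMr// mul1r leNgt truncnS_gt.
Qed.

End FacetLaw.

(** * Asymptotics *)

Section BinomialTail.
Context {R : realType}.

Lemma bernoulli_le (x : R) s : 0 <= x <= 1 -> 1 - s%:R * x <= (1 - x) ^+ s.
Proof.
move=> /andP[x0 x1]; elim: s => [|s IH]; first by rewrite mul0r subr0 expr0.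
have y0 : 0 <= (1 - x) ^+ s by rewrite exprn_ge0 ?subr_ge0.
have y1 : (1 - x) ^+ s <= 1 by rewrite exprn_ile1 ?subr_ge0// lerBlDr lerDl.
rewrite exprS mulrBl mul1r -natr1 mulrDl mul1r opprD addrA.
by apply: lerB; [exact: IH|rewrite ler_piMr].
Qed.

Lemma subset_weights_sum N (p q : R) :
  \sum_(I : {set 'I_N}) p ^+ #|I| * q ^+ (N - #|I|) = (p + q) ^+ N.
Proof.
have -> : (p + q) ^+ N = \prod_(i < N) (p + q) by rewrite prodr_const card_ord.
rewrite bigA_distr; apply: eq_bigr => I _.
rewrite (bigID (mem I))/= (eq_bigr (fun=> p)); last by move=> i ->.
rewrite [X in _ = _ * X](eq_bigr (fun=> q)); last by move=> i /negPf ->.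
rewrite !prodr_const; congr (_ * _ ^+ _).
have := cardsC I; rewrite card_ord => h.
rewrite (_ : (N - #|I|)%N = #|~: I|); last by lia.
by apply: eq_card => i; rewrite !inE.
Qed.

(** An exponential Markov inequality: for [#|I| < m] the weight [p ^+ #|I|] is at most
    [2 ^+ m * (p / 2) ^+ #|I|], and the weights with [p / 2] in place of [p] add up to
    [(1 - p / 2) ^+ N]. *)
Lemma binomial_tail N m (p : R) : 0 <= p <= 1 ->
  1 - 2 ^+ m * (1 - p / 2) ^+ N <=
  \sum_(I : {set 'I_N} | (m <= #|I|)%N) p ^+ #|I| * (1 - p) ^+ (N - #|I|).
Proof.
move=> /andP[p0 p1].
have := subset_weights_sum N p (1 - p); rewrite subrKC expr1n => E.
rewrite -{1}E [X in X - _](bigID (fun I : {set 'I_N} => (m <= #|I|)%N))/=.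
rewrite lerBlDr lerD2l.
have -> : 1 - p / 2 = p / 2 + (1 - p) by lra.
rewrite -(subset_weights_sum N (p / 2) (1 - p)) mulr_sumr big_mkcond/=; apply: ler_sum => I _.
have w0 k : 0 <= p ^+ k * (1 - p) ^+ (N - #|I|).
  by rewrite mulr_ge0// exprn_ge0// subr_ge0.
have v0 : 0 <= (p / 2) ^+ #|I| * (1 - p) ^+ (N - #|I|).
  by rewrite mulr_ge0// exprn_ge0// ?subr_ge0// divr_ge0.
case: leqP => mI /=; first by rewrite mulr_ge0// exprn_ge0.
have -> : p ^+ #|I| = 2 ^+ #|I| * (p / 2) ^+ #|I| by rewrite -exprMn mulrC divfK.
by rewrite -mulrA ler_wpM2r// ler_weXn2l ?ler1n// ltnW.
Qed.

Lemma ln_eventually_ge (C : R) : exists N0, forall N, (N0 <= N)%N -> C <= ln N%:R.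
Proof.
exists (Num.truncn (expR C)).+1 => N hN.
rewrite -[C]expRK ler_ln ?posrE ?expR_gt0//; last first.
  by rewrite ltr0n; exact: leq_trans hN.
by apply: ltW; apply: lt_le_trans (truncnS_gt _) _; rewrite ler_nat.
Qed.

(* With [m = N %/ r], [ln m / ln N] tends to 1 and a binomial variable of parameters [N]
   and [p] is at least [m] with probability tending to 1. *)
Lemma binomial_ln_lower (p : R) s K (e : R) : 0 < p <= 1 -> 0 < e <= 1 ->
  exists N0, forall N, (N0 <= N)%N -> exists2 m, (K <= m)%N &
    (1 - e) * ln N%:R ^+ s <= ln m%:R ^+ s *
     \sum_(I : {set 'I_N} | (m <= #|I|)%N) p ^+ #|I| * (1 - p) ^+ (N - #|I|).
Proof.
move=> /andP[p0 p1] /andP[e0 e1].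
(* The error is split into [s.+1] equal parts: [s] for the powers of the logarithm, by Bernoulli's
   inequality, and one for the probability. *)
pose t := e / s.+1%:R.
have t0 : 0 < t by rewrite divr_gt0.
have t1 : t <= 1.
  by rewrite ler_pdivrMr// mul1r (le_trans e1)// ler1n.
have te : 1 - e <= (1 - s%:R * t) * (1 - t).
  have : s%:R * t + t = e by rewrite -{2}[t]mul1r -mulrDl natr1 mulrC divfK.
  have : 0 <= s%:R * t * t by rewrite !mulr_ge0// ltW.
  by move: (s%:R * t) => u; rewrite mulrBl mul1r; nra.
(* This [r] beats the factor [2 ^+ m] of the tail: since [r * m <= N], the failure probability is at
   most [2 ^- m]. *)
have [r r0 rP] : exists2 r, (0 < r)%N & (1 - p / 2) ^+ r <= 4^-1.
  have z1 : `|1 - p / 2| < 1 by rewrite ltr_norml; lra.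
  have q0 : 0 < 4^-1 :> R by rewrite invr_gt0.
  have /cvgrPdist_le/(_ _ q0)[n0 _ Hn] := cvg_expr z1.
  exists n0.+1 => //; have := Hn n0.+1 (leqnSn _); rewrite /= sub0r normrN.
  exact/le_trans/ler_norm.
(* For [N >= N1], [ln (2 * r)] is at most [t * ln N], and [N <= 2 * r * m] then gives
   [ln m >= (1 - t) * ln N]. *)
have [N1 HN1] := ln_eventually_ge ((ln (2 * r)%:R : R) / t).
(* [m >= M] ensures [K <= m], [0 < m] and [2 ^- m <= t]. *)
pose M := (Num.truncn t^-1 + K + 2)%N.
exists (N1 + (M * r + 2))%N => N hN.
have hN1 : (N1 <= N)%N by apply: leq_trans hN; rewrite leq_addr.
have hMr : (M * r <= N)%N by apply: leq_trans hN; rewrite addnCA leq_addr.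
have hN2 : (1 < N)%N by apply: leq_trans hN; rewrite addnA addn2.
pose m := (N %/ r)%N.
have Mm : (M <= m)%N by rewrite leq_divRL.
have MK : (K <= M)%N by rewrite /M -addnA addnCA leq_addr.
exists m; first exact: leq_trans Mm.
have lnN0 : 0 < ln (N%:R : R) by rewrite ln_gt0// ltr1n.
have h1 : (1 - t) * ln N%:R <= ln m%:R.
  have : ln (N%:R : R) <= ln (2 * r)%:R + ln m%:R.
    have m0 : (0 < m)%N by apply: leq_trans Mm; rewrite /M addn2.
    rewrite -lnM ?posrE ?ltr0n ?muln_gt0 ?r0// -natrM.
    rewrite ler_ln ?posrE ?ltr0n ?muln_gt0 ?r0 ?m0//; last exact: ltnW.
    rewrite ler_nat {1}(divn_eq N r) -/m -mulnA mul2n -addnn (mulnC r) leq_add2l.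
    by rewrite (leq_trans (ltnW (ltn_pmod N r0)))// leq_pmull.
  have : (ln (2 * r)%:R : R) / t <= ln N%:R by exact: HN1.
  rewrite ler_pdivrMr// mulrBl mul1r; lra.
have h2 : 1 - t <= \sum_(I : {set 'I_N} | (m <= #|I|)%N) p ^+ #|I| * (1 - p) ^+ (N - #|I|).
  apply: le_trans (binomial_tail N m _); last by rewrite ltW.
  rewrite lerD2l lerN2.
  have y0 : 0 <= 1 - p / 2 by lra.
  have y1 : 1 - p / 2 <= 1 by lra.
  apply: (@le_trans _ _ (2 ^+ m * (4^-1) ^+ m)).
    rewrite ler_wpM2l ?exprn_ge0//.
    rewrite (divn_eq N r) -/m exprD mulnC exprM.
    apply: (@le_trans _ _ (((1 - p / 2) ^+ r) ^+ m)).
      by rewrite ler_piMr ?exprn_ge0// exprn_ile1.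
    by rewrite lerXn2r ?nnegrE ?exprn_ge0 ?invr_ge0.
  rewrite -exprMn (_ : 2 * 4^-1 = 2^-1); last by lra.
  rewrite exprVn invf_ple ?posrE ?exprn_gt0//.
  apply: (@le_trans _ _ m%:R); last by rewrite -natrX ler_nat ltnW// ltn_expl.
  apply: ltW; apply: lt_le_trans (truncnS_gt _) _; rewrite ler_nat.
  by apply: leq_trans Mm; rewrite /M addn2 !ltnS -addnS leq_addr.
apply: (le_trans (ler_wpM2r _ te)); first by rewrite exprn_ge0// ltW.
rewrite mulrAC; apply: ler_pM => //.
- rewrite mulr_ge0 ?exprn_ge0 ?(ltW lnN0)// subr_ge0.
  rewrite mulrA ler_pdivrMr// mul1r (@le_trans _ _ s%:R) ?ler_nat//.
  by rewrite ler_piMr.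
- by rewrite subr_ge0.
apply: (@le_trans _ _ (((1 - t) * ln N%:R) ^+ s)).
  rewrite exprMn ler_wpM2r ?exprn_ge0 ?(ltW lnN0)//.
  by apply: bernoulli_le; rewrite (ltW t0).
rewrite lerXn2r ?nnegrE//.
- by rewrite mulr_ge0 ?(ltW lnN0)// subr_ge0.
- by rewrite (le_trans _ h1)// mulr_ge0 ?(ltW lnN0)// subr_ge0.
Qed.


End BinomialTail.

(** * Uniformity of the face asymptotics over sample spaces *)

Section UniformSpaces.

(** Bundling a sample with its probability space lets a space be chosen for each [k]. *)
Record uniform_space (R : realType) (d k : nat) (Q : set 'rV[R]_d) := UniformSpace {
  us_disp : measure_display;
  us_T : measurableType us_disp;
  us_Pr : probability us_T R;
  us_X : 'I_k -> {RV us_Pr >-> borel_rV R d};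
  us_law : uniform_sample (@lebesgue_rV R d) Q us_X }.

(* The defining property of the constant holds for every choice of sample spaces, hence
   for a worst one: this makes the estimate uniform over the spaces. *)
Lemma face_constant_lower (R : realType) (d l : nat) (c : R) (Q : set 'rV[R]_d) (e : R) :
  is_face_constant d l c -> is_polytope Q -> has_dim Q d -> 0 <= c -> 0 < e ->
  (forall k, inhabited (uniform_space k Q)) ->
  exists K, forall k, (K <= k)%N -> forall S : uniform_space k Q,
    ((c * (nflags Q)%:R * ln k%:R ^+ d.-1 * (1 - e))%:E <= expected_nfaces l (us_X S))%E.
Proof.
move=> hc Qp Qd c0 e0 inh.
pose good k (S : uniform_space k Q) :=
  ((c * (nflags Q)%:R * ln k%:R ^+ d.-1 * (1 - e))%:E <= expected_nfaces l (us_X S))%E.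
have worst k : exists S : uniform_space k Q, good k S -> forall S', good k S'.
  have [[S bS]|no] := pselect (exists S : uniform_space k Q, ~ good k S).
    by exists S.
  by have [S] := inh k; exists S => _ S'; apply: contrapT => bS'; apply: no; exists S'.
have worstS k : {S : uniform_space k Q | good k S -> forall S', good k S'}.
  exact: cid (worst k).
pose S k := projT1 (worstS k).
have [err err0 [N1 _ HN1]] := hc Q Qp Qd (fun k => us_disp (S k)) (fun k => us_T (S k))
  (fun k => us_Pr (S k)) (fun k => us_X (S k)) (fun k => us_law (S k)).
have /cvgrPdist_le/(_ _ e0)[N2 _ HN2] := err0.
exists (maxn (maxn N1 N2) 1) => k; rewrite !geq_max => /andP[/andP[k1 k2] k3] S'.
apply: (projT2 (worstS k)); rewrite /good -/(S k) (HN1 k k1) lee_fin.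
apply: ler_wpM2l.
  by rewrite !mulr_ge0// exprn_ge0// ln_ge0// ler1n.
by have := HN2 k k2; rewrite /= sub0r normrN lerD2l ler_norml => /andP[].
Qed.

End UniformSpaces.

(** * Contribution of one facet *)

Section FacetContribution.
Import HBNNSimple.
Variables (R : realType) (d l : nat) (c : R).
Hypothesis hc : is_face_constant d.+1 l c.
Hypothesis c0 : 0 <= c.
Variable P : set 'rV[R]_d.+2.
Hypotheses (hP : is_polytope P) (hdim : has_dim P d.+2).
Variables (disp : nat -> measure_display) (T : forall N, measurableType (disp N))
  (Pr : forall N, probability (T N) R)
  (X : forall N, 'I_N -> {RV (Pr N) >-> borel_rV R d.+2}).
Hypothesis hX : forall N, uniform_sample (@hausdorff R d.+2 d.+1) (boundary P) (@X N).

(** [g] is the sum over index sets [I] of simple functions [h I] cut off to their events. The events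
    are disjoint, so at each [w] at most one term survives; index sets with fewer than [m] elements
    are only bounded below by 0. *)
Lemma facet_contribution (F : set 'rV[R]_d.+2) (e : R) : is_face P F -> has_dim F d.+1 ->
  0 < e <= 1 -> exists Q : set 'rV[R]_d.+1,
  (is_polytope Q /\ exists p0 (B : 'M[R]_(d.+1, d.+2)),
     [/\ row_free B, forall x, F x -> (x - p0 <= B)%MS & Q = chart p0 B @` F]) /\
  exists N0, forall N, (N0 <= N)%N -> exists g : T N -> \bar R,
    [/\ measurable_fun setT g, forall w, (0 <= g w)%E,
      forall w, (forall i, P (X i w)) ->
        (g w <= (count (fun G => `[< G `<=` F >]) (fset_set [set G |
          is_face (conv_hull (range (fun i : 'I_N => X i w : 'rV[R]_d.+2))) G
          /\ has_dim G l]))%:R%:E)%E &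
      ((c * (nflags Q)%:R * ln N%:R ^+ d * (1 - e))%:E <= \int[Pr N]_w g w)%E].
Proof.
move=> PF Fd /andP[e0 e1].
have [h0 hoo] := uniform_boundary_fin ((hX 1).1 ord0).
have [p0 [B []]] := facet_law hP hdim PF Fd h0 hoo.
set Q := chart p0 B @` F => p [[fB FB Qp Qd] [pp0 pE qE]].
exists Q; split; first by split=> //; exists p0, B.
have mF : measurable (F : set (borel_rV R d.+2)).
  apply: closed_borel; apply: polytope_closed; exact: face_polytope hP PF.
have mch := continuous_borel (@chart_continuous R _ _ p0 B).
pose q (A : set (borel_rV R d.+1)) := fine (lebesgue_rV (A `&` Q)) / fine (lebesgue_rV Q).
have XF N (i : 'I_N) : Pr N (X i @^-1` F) = p%:E.
  by rewrite -pE; exact: (hX N).1 i F mF.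
have Xq N (i : 'I_N) (A : set (borel_rV R d.+1)) : measurable A ->
    Pr N (X i @^-1` (F `&` chart p0 B @^-1` A)) = (p * q A)%:E.
  move=> mA; rewrite /q -qE//; apply: ((hX N).1 i (F `&` chart p0 B @^-1` A)).
  by apply: measurableI => //; rewrite -[_ @^-1` _]setTI; exact: mch.
have p1 : p <= 1.
  by rewrite -lee_fin -(XF 1%N ord0); apply/probability_le1/measurable_funPTI.
have law N k (f : 'I_k -> 'I_N) (fi : injective f) :
    (0 < Pr N (hit_event (@X N) F f))%E ->
    uniform_sample (@lebesgue_rV R d.+1) Q (cond_RV (@X N) mF mch fi).
  move=> E0; split; last exact: (cond_RV_independent (hX N).2 mF (XF N) mch (Xq N) fi E0).
  by move=> j A mA; exact: (cond_RV_distribution (hX N).2 mF (XF N) mch (Xq N) fi E0 j mA).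
have hitP N k (f : 'I_k -> 'I_N) (fi : injective f) :
    Pr N (hit_event (@X N) F f) = (p ^+ k * (1 - p) ^+ (N - k))%:E.
  exact: (hit_event_prob0 (hX N).2 mF (XF N) mch (Xq N) fi).
(* Conditioning on all [k] points falling in [F], an event of probability [p ^+ k], produces such a
   space. *)
have inh k : inhabited (uniform_space k Q).
  have idi : injective (fun i : 'I_k => i) by [].
  have E0 : (0 < Pr k (hit_event (@X k) F (fun i : 'I_k => i)))%E.
    by rewrite hitP// subnn expr0 mulr1 lte_fin exprn_gt0.
  by constructor; exact: (UniformSpace (law _ _ _ idi E0)).
(* One [a] is lost in the face asymptotics and one in the binomial estimate:
   [(1 - a)^2 >= 1 - e]. *)
pose a := e / 2.
have a0 : 0 < a by rewrite divr_gt0.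
have a1 : a <= 1 by rewrite /a; lra.
(* The asymptotics is taken with error [a / 2] so that the bound with error [a] is strict, as
   extracting a simple function from a supremum requires. *)
have [K HK] := face_constant_lower hc Qp Qd c0 (divr_gt0 a0 (ltr0n R 2)) inh.
have p01 : 0 < p <= 1 by rewrite pp0.
have a01 : 0 < a <= 1 by rewrite a0.
have [N0 HN0] := binomial_ln_lower d (maxn K 2) p01 a01.
exists (maxn N0 1) => N; rewrite geq_max => /andP[/HN0[m]].
rewrite geq_max => /andP[Km m2] mN N1.
pose L := c * (nflags Q)%:R * ln m%:R ^+ d * (1 - a).
pose ev (I : {set 'I_N}) : 'I_#|I| -> 'I_N := enum_val.
have evi I : injective (@ev I) by exact: enum_val_inj.
pose E I := hit_event (@X N) F (@ev I).
have mE I : measurable (E I) by exact: (measurable_hit_event (@X N) mF mch (@evi I)).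
have lnm : 0 < ln (m%:R : R) by rewrite ln_gt0// ltr1n.
have key (I : {set 'I_N}) : (m <= #|I|)%N -> exists h : {nnsfun T N >-> R},
    (forall w : T N, h w <= (nfaces l (conv_hull
       (range (chart p0 B \o (fun i : 'I_N => X i w : 'rV[R]_d.+2) \o @ev I))))%:R) /\
    ((L * fine (Pr N (E I)))%:E <= \int[Pr N]_(w in E I) (h w)%:E)%E.
  move=> mI.
  (* The zero function serves when the required bound is not positive; this covers null events, for
     which conditioning says nothing. *)
  have triv : L * fine (Pr N (E I)) <= 0 -> exists h : {nnsfun T N >-> R},
      (forall w : T N, h w <= (nfaces l (conv_hull
         (range (chart p0 B \o (fun i : 'I_N => X i w : 'rV[R]_d.+2) \o @ev I))))%:R) /\
      ((L * fine (Pr N (E I)))%:E <= \int[Pr N]_(w in E I) (h w)%:E)%E.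
    move=> L0; exists nnsfun0; split=> [w|]; first by rewrite ler0n.
    by apply: (@le_trans _ _ 0%E); rewrite ?lee_fin// integral_ge0.
  have [L0|L0] := leP L 0.
    by apply: triv; rewrite mulr_le0_ge0// fine_ge0.
  have [PE0|PEne] := eqVneq (Pr N (E I)) 0%E.
    by apply: triv; rewrite PE0 mulr0.
  have PE : (0 < Pr N (E I))%E by rewrite lt_neqAle eq_sym PEne measure_ge0.
  have cf0 : 0 < c * (nflags Q)%:R * ln (m%:R : R) ^+ d.
    rewrite lt_neqAle !mulr_ge0 ?exprn_ge0 ?(ltW lnm)// andbT.
    by apply: contraTneq L0 => cf; rewrite /L -cf mul0r ltxx.
  have LE : L < c * (nflags Q)%:R * ln (#|I|%:R : R) ^+ d * (1 - a / 2).
    apply: (@lt_le_trans _ _ (c * (nflags Q)%:R * ln (m%:R : R) ^+ d * (1 - a / 2))).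
      by rewrite /L ltr_pM2l//; lra.
    rewrite ler_wpM2r//; first by lra.
    rewrite ler_wpM2l ?mulr_ge0// lerXn2r ?nnegrE ?(ltW lnm)//.
      by rewrite ln_ge0// ler1n; exact: leq_trans (ltnW m2) mI.
    by rewrite ler_ln ?posrE ?ltr0n ?ler_nat//; [exact: ltnW|exact: leq_trans (ltnW m2) mI].
  have := HK #|I| (leq_trans Km mI) (UniformSpace (law _ _ _ (evi I) PE)).
  rewrite -lte_fin in LE; move=> /(lt_le_trans LE).
  move=> /(lower_expectation_cond PE _)[|h hle hint]; first by move=> w; rewrite ler0n.
  by exists h.
pose cI (I : {set 'I_N}) := if (m <= #|I|)%N then L * fine (Pr N (E I)) else 0.
have /choice[h hPr] (I : {set 'I_N}) : exists h : {nnsfun T N >-> R},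
    (forall w : T N, h w <= (nfaces l (conv_hull
       (range (chart p0 B \o (fun i : 'I_N => X i w : 'rV[R]_d.+2) \o @ev I))))%:R) /\
    ((cI I)%:E <= \int[Pr N]_(w in E I) (h w)%:E)%E.
  rewrite /cI; case: ifPn => [/key//|_].
  by exists nnsfun0; split=> [w|]; [rewrite ler0n|rewrite integral_ge0].
have mh I D : measurable_fun D (EFin \o h I).
  by apply/measurable_EFinP; apply: measurable_funTS.
have mhE I : measurable_fun setT ((EFin \o h I) \_ (E I)).
  exact/(measurable_restrictT _ (mE I)).1.
have hE0 I w : (0 <= ((EFin \o h I) \_ (E I)) w)%E.
  by rewrite /patch; case: ifP => // _; rewrite lee_fin.
exists (fun w => \sum_(I : {set 'I_N}) ((EFin \o h I) \_ (E I)) w)%E; split.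
- by apply: emeasurable_sum => I _; exact: mhE.
- by move=> w; rewrite sume_ge0.
- move=> w Pw; have [u [b [Pb FE]]] := PF.
  pose I0 := [set i | `[< F (X i w) >]]%SET.
  have EI I : E I w -> I = I0.
    move=> Ew; apply/setP => i; rewrite inE; apply/idP/asboolP.
      by move=> iI; apply/Ew; exists (enum_rank_in iI i); exact: enum_rankK_in.
    by move=> /Ew[j <-]; exact: enum_valP.
  rewrite (bigD1 I0)//= big1 ?adde0; last first.
    by move=> I II0; rewrite patchE ifF//; apply/negbTE/negP => /set_mem/EI; apply/eqP.
  rewrite patchE; case: ifPn => [/set_mem Ew|_]; last by rewrite lee_fin.
  rewrite /= lee_fin; apply: (le_trans ((hPr I0).1 w)); rewrite ler_nat.
  rewrite FE; apply: (nfaces_chart_le _ hP Pb fB) => //; first by rewrite -FE.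
  move=> i; split=> [xb|/Ew].
    by apply/Ew; rewrite FE.
  by rewrite FE => -[].
- rewrite ge0_integral_sum//.
  rewrite (eq_bigr (fun I => \int[Pr N]_(w in E I) (h I w)%:E)%E); last first.
    by move=> I _; rewrite [RHS]integral_mkcond.
  apply: (@le_trans _ _ (\sum_(I : {set 'I_N}) (cI I)%:E)%E); last first.
    by apply: lee_sum => I _; exact: (hPr I).2.
  rewrite sumEFin lee_fin /cI -big_mkcond/=.
  rewrite (eq_bigr (fun I : {set 'I_N} => L * (p ^+ #|I| * (1 - p) ^+ (N - #|I|)))); last first.
    by move=> I _; rewrite /E hitP.
  rewrite -mulr_sumr /L.
  have cf0 : 0 <= c * (nflags Q)%:R by rewrite mulr_ge0.
  have lN0 : 0 <= ln (N%:R : R) ^+ d by rewrite exprn_ge0// ln_ge0// ler1n.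
  rewrite -[leLHS]mulrA -[X in _ <= X]mulrA -[X in _ <= X]mulrA ler_wpM2l//.
  rewrite mulrC [X in _ <= X]mulrCA.
  apply: (@le_trans _ _ ((1 - a) * ((1 - a) * ln N%:R ^+ d))).
    by rewrite mulrA ler_wpM2r// /a; nra.
  by rewrite ler_wpM2l// subr_ge0.
Qed.
End FacetContribution.

(** * Summation over the facets *)

Section LowerBound.
Variables (R : realType) (d l : nat) (c : R).
Hypothesis hc : is_face_constant d.+1 l c.
Hypothesis c0 : 0 <= c.
Variable P : set 'rV[R]_d.+2.
Hypotheses (hP : is_polytope P) (hdim : has_dim P d.+2).
Variables (disp : nat -> measure_display) (T : forall N, measurableType (disp N))
  (Pr : forall N, probability (T N) R)
  (X : forall N, 'I_N -> {RV (Pr N) >-> borel_rV R d.+2}).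
Hypothesis hX : forall N, uniform_sample (@hausdorff R d.+2 d.+1) (boundary P) (@X N).

Let r : seq (set 'rV[R]_d.+2) := fset_set [set F | is_face P F /\ has_dim F d.+1].

Let rP F : F \in r -> is_face P F /\ has_dim F d.+1.
Proof.
rewrite /r in_fset_set ?inE//.
by apply: sub_finite_set (finite_faces hP) => G [].
Qed.

(** The exceptional set is covered by finitely many null sets: some point lies outside [P], or in
    two distinct facets. *)
Lemma sample_general_position N : exists2 Z : set (T N),
  measurable Z /\ Pr N Z = 0%E & forall w, ~ Z w ->
  (forall i, P (X i w)) /\
  (forall i F G, F \in r -> G \in r -> F (X i w) -> G (X i w) -> F = G).
Proof.
have inP i : almost_everywhere (Pr N) (fun w => P (@X N i w)).
  have [h0 hoo] := uniform_boundary_fin ((hX N).1 i).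
  have mP : measurable (P : set (borel_rV R d.+2)).
    by apply: closed_borel; exact: polytope_closed.
  have PX : Pr N (@X N i @^-1` P) = 1%E.
    rewrite -[LHS]/(distribution (Pr N) (@X N i) P) ((hX N).1 i P mP).
    rewrite setIidr ?divff ?gt_eqF// => x [clP _].
    by have /closure_id -> := polytope_closed hP.
  exists (@X N i @^-1` (~` P)); split => //.
    by apply: measurable_funPTI; exact: measurableC.
  by rewrite preimage_setC probability_setC ?PX ?subee//; apply: measurable_funPTI.
have notFG i F G : F \in r -> G \in r -> F <> G ->
    almost_everywhere (Pr N) (fun w => ~ (F `&` G) (@X N i w)).
  move=> /rP[PF Fd] /rP[PG Gd] FG; exists (@X N i @^-1` (F `&` G)); split.
  - apply: measurable_funPTI; apply: closed_borel; apply: closedI;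
      apply: polytope_closed; exact: face_polytope hP _.
  - exact: (facets_meet_null hP hdim PF Fd PG Gd FG ((hX N).1 i)).
  - by move=> w /contrapT.
(* Facets are replaced by their positions in [r], because [filter_forall] ranges over a finite
   type. *)
pose bad i (u v : 'I_(size r)) (w : T N) := nth set0 r u <> nth set0 r v ->
  ~ (nth set0 r u `&` nth set0 r v) (@X N i w).
have aebad i u v : almost_everywhere (Pr N) (bad i u v).
  have [eq_uv|ne] := pselect (nth set0 r u = nth set0 r v).
    by apply: filterS filterT => w _ /(_ eq_uv).
  by apply: filterS (notFG i _ _ (mem_nth _ (ltn_ord u)) (mem_nth _ (ltn_ord v)) ne)
    => w nH _.
have FF : Filter (almost_everywhere (Pr N)) by exact: ae_filter_ringOfSetsType.
have aeP := @filter_forall _ _ (fun i w => P (@X N i w)) (almost_everywhere (Pr N)) FF inP.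
have ae1 i u := @filter_forall _ _ (fun v w => bad i u v w)
  (almost_everywhere (Pr N)) FF (aebad i u).
have ae2 i := @filter_forall _ _ (fun u w => forall v, bad i u v w)
  (almost_everywhere (Pr N)) FF (ae1 i).
have ae3 := @filter_forall _ _ (fun i w => forall u v, bad i u v w)
  (almost_everywhere (Pr N)) FF ae2.
have [Z [mZ Z0 ZP]] := filterI aeP ae3; exists Z => // w nZw.
have [Pw Fw] : (forall i, P (@X N i w)) /\ forall i u v, bad i u v w.
  by apply: contrapT => H; apply: nZw; exact: ZP.
split=> // i F G Fr Gr Fx Gx; apply: contrapT => FG.
have Fi := Fr; have Gi := Gr; rewrite -index_mem in Fi; rewrite -index_mem in Gi.
have := Fw i (Ordinal Fi) (Ordinal Gi); rewrite /bad /= !nth_index//.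
by move=> /(_ FG); apply.
Qed.

Lemma expected_nfaces_lower (e : R) : 0 < e <= 1 -> exists N0, forall N, (N0 <= N)%N ->
  ((c * (nflags P)%:R * ln N%:R ^+ d * (1 - e))%:E <= expected_nfaces l (@X N))%E.
Proof.
move=> e01; have /andP[e0 e1] := e01.
pose spec F Q N0 := (is_polytope Q /\ exists p0 (B : 'M[R]_(d.+1, d.+2)),
     [/\ row_free B, forall x, F x -> (x - p0 <= B)%MS & Q = chart p0 B @` F]) /\
  forall N, (N0 <= N)%N -> exists g : T N -> \bar R,
    [/\ measurable_fun setT g, forall w, (0 <= g w)%E,
      forall w, (forall i, P (X i w)) ->
        (g w <= (count (fun G => `[< G `<=` F >]) (fset_set [set G |
          is_face (conv_hull (range (fun i : 'I_N => X i w : 'rV[R]_d.+2))) G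
          /\ has_dim G l]))%:R%:E)%E &
      ((c * (nflags Q)%:R * ln N%:R ^+ d * (1 - e))%:E <= \int[Pr N]_w g w)%E].
have /choice[QN QNP] F : exists QN : set 'rV[R]_d.+1 * nat,
    is_face P F -> has_dim F d.+1 -> spec F QN.1 QN.2.
  have [[PF Fd]|no] := pselect (is_face P F /\ has_dim F d.+1).
    have [Q [Q1 [N0 Q2]]] := facet_contribution hc c0 hP hdim hX PF Fd e01.
    by exists (Q, N0).
  by exists (set0, 0%N) => ? ?; exfalso; apply: no.
have flagsP : (nflags P <= \sum_(F <- r) nflags (QN F).1)%N.
  by apply: nflags_le_facets => // F PF Fd; have [] := QNP F PF Fd.
exists (maxn 1 (\max_(F <- r) (QN F).2)) => N; rewrite geq_max => /andP[N1 hN].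
have /choice[g gP] F : exists g : T N -> \bar R, F \in r ->
    [/\ measurable_fun setT g, forall w, (0 <= g w)%E,
      forall w, (forall i, P (X i w)) ->
        (g w <= (count (fun G => `[< G `<=` F >]) (fset_set [set G |
          is_face (conv_hull (range (fun i : 'I_N => X i w : 'rV[R]_d.+2))) G
          /\ has_dim G l]))%:R%:E)%E &
      ((c * (nflags (QN F).1)%:R * ln N%:R ^+ d * (1 - e))%:E <= \int[Pr N]_w g w)%E].
  have [Fr|nFr] := boolP (F \in r); last by exists (cst 0%E).
  have [PF Fd] := rP Fr; have [_ /(_ N)] := QNP F PF Fd.
  move=> [|g gP]; last by exists g.
  by apply: leq_trans hN; exact: leq_bigmax_seq.
(* [g F] is controlled only for facets; the value 0 elsewhere gives measurability at every index, as
   the lemma on sums asks. *)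
pose G F w := if F \in r then g F w else 0%E.
have mG F : measurable_fun setT (G F).
  rewrite /G; have [Fr|_] := boolP (F \in r); last exact: measurable_cst.
  by have [] := gP F Fr.
have G0 F w : (0 <= G F w)%E.
  by rewrite /G; have [Fr|//] := boolP (F \in r); have [_ + _ _] := gP F Fr; apply.
have [Z [mZ Z0] ZP] := sample_general_position N.
have mS : measurable_fun setT (fun w => \sum_(F <- r) G F w)%E.
  exact: emeasurable_sum.
have S0 w : (0 <= \sum_(F <- r) G F w)%E by rewrite sume_ge0.
apply: (@le_trans _ _ (\int[Pr N]_w \sum_(F <- r) G F w)%E).
  rewrite ge0_integral_sum//.
  apply: (@le_trans _ _ (\sum_(F <- r) (c * (nflags (QN F).1)%:R * ln N%:R ^+ d * (1 - e))%:E)%E).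
    rewrite sumEFin lee_fin -!mulr_suml -mulr_sumr.
    rewrite ler_wpM2r ?subr_ge0// ler_wpM2r ?exprn_ge0 ?ln_ge0 ?ler1n//.
    by rewrite ler_wpM2l// -natr_sum ler_nat.
  rewrite big_seq [leRHS]big_seq; apply: lee_sum => F Fr.
  by have [_ _ _] := gP F Fr; rewrite /G Fr.
(* The pointwise comparison can fail only on the null set [Z], so the integrand is set to 0
   there. *)
rewrite (ge0_negligible_integral mZ measurableT mS _ Z0)// setTD integral_mkcond.
apply: le_lower_expectation.
- by move=> w; rewrite ler0n.
- by move=> w; rewrite patchE; case: ifP.
- by apply/(measurable_restrictT _ (measurableC mZ)).1; exact: measurable_funTS.
move=> w; rewrite patchE; case: ifPn => [/set_mem nZw|_]; last by rewrite lee_fin ler0n.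
have [Pw Fw] := ZP w nZw.
apply: (@le_trans _ _ (\sum_(F <- r) (count (fun G => `[< G `<=` F >]) (fset_set [set G |
          is_face (conv_hull (range (fun i : 'I_N => X i w : 'rV[R]_d.+2))) G
          /\ has_dim G l]))%:R%:E)%E).
  rewrite big_seq [leRHS]big_seq; apply: lee_sum => F Fr.
  by rewrite /G Fr; have [_ _ + _] := gP F Fr; apply.
rewrite sumEFin lee_fin -natr_sum ler_nat.
apply: sum_count_faces_le; first exact: fset_uniq.
exact: Fw.
Qed.

End LowerBound.

Unset Implicit Arguments.

Theorem mainTheorem4 (R : realType) (n l : nat) (c : R)
    (hn : (3 <= n)%N) (hl : (1 <= l <= n - 2)%N)
    (hc : is_face_constant n.-1 l c)
    (P : set 'rV[R]_n) (hP : is_polytope P) (hdim : has_dim P n)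
    (disp : nat -> measure_display)
    (T : forall N, measurableType (disp N))
    (Pr : forall N, probability (T N) R)
    (X : forall N, 'I_N -> {RV (Pr N) >-> borel_rV R n})
    (hX : forall N,
      uniform_sample (@hausdorff R n n.-1) (boundary P) (@X N)) :
  exists2 o : nat -> R, o @ \oo --> 0 &
    \forall N \near \oo,
      ((c * (nflags P)%:R * ln N%:R ^+ (n - 2) * (1 + o N))%:E
        <= expected_nfaces l (@X N))%E.
Proof.
case: n hn hl P hc hP hdim X hX => [//|[//|d]] hn _ P hc hP hdim X hX.
rewrite subn2/=.
have E0 N : (0 <= expected_nfaces l (@X N))%E.
  by apply: expectation_ge0 => w; rewrite ler0n.
(* If the leading constant is not positive, neither is the claimed bound, and the error term 0
   works. Otherwise [c] is nonnegative. *)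
have [cf|cf] := leP (c * (nflags P)%:R) 0.
  exists (fun=> 0); first exact: cvg_cst.
  exists 1%N => // N N1; apply: le_trans (E0 N); rewrite lee_fin addr0 mulr1.
  by rewrite mulr_le0_ge0// exprn_ge0// ln_ge0// ler1n.
have c0 : 0 <= c.
  by rewrite leNgt; apply/negP => c0; move: cf; rewrite ltNge mulr_le0_ge0// ltW.
have low := expected_nfaces_lower hc c0 hP hdim hX.
pose u N : R := c * (nflags P)%:R * ln N%:R ^+ d.
have u0 N : (2 <= N)%N -> 0 < u N.
  by move=> N2; rewrite mulr_gt0// exprn_gt0// ln_gt0// ltr1n.
(* The relative deficit, equal to 0 when the expectation reaches the leading term or is infinite.
   Any excess is truncated since only a lower bound is claimed; [low], applied to every small error,
   forces the limit 0. *)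
pose err N : R := if expected_nfaces l (@X N) is x%:E then Num.min 0 (x / u N - 1) else 0.
exists err.
  apply/cvgrPdist_le => e e0.
  have e'01 : 0 < Num.min e 1 <= 1 by rewrite lt_min e0 ltr01 ge_min lexx orbT.
  have [N0 HN0] := low _ e'01.
  exists (maxn N0 2) => // N; rewrite /= geq_max => /andP[/HN0 hN /u0 uN].
  rewrite sub0r normrN /err; move: hN; case: (expected_nfaces l (@X N)) => [x| |].
  - rewrite lee_fin -/(u N) mulrC -ler_pdivlMr// => hx.
    have ze : Num.min e 1 <= e by rewrite ge_min lexx.
    rewrite ler_norml le_min ge_min (ltW e0) andbT.
    by apply/andP; split; lra.
  - by move=> _; rewrite normr0 ltW.
  - by move=> _; rewrite normr0 ltW.
exists 2%N => // N /u0 uN; rewrite -/(u N) /err.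
case: (expected_nfaces l (@X N)) (E0 N) => [x _| |//]; last by move=> _; rewrite leey.
rewrite lee_fin mulrC -ler_pdivlMr//.
have : Num.min 0 (x / u N - 1) <= x / u N - 1 by rewrite ge_min lexx orbT.
by lra.
Qed.
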